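(* Let $p$ be a prime. The ascending union $$G:=\bigcup_{n\in\mathbb{N}_0}\bigl(\mathbb{Q}_p*_{\mathbb{Z}_p}\mathbb{Q}_p*_{p\mathbb{Z}_p}\cdots*_{p^n\mathbb{Z}_p}\mathbb{Q}_p\bigr)$$ of iterated amalgamated products can be made a $1$-dimensional $p$-adic Lie group with the following properties: (a) $\operatorname{Ad}(g)=\operatorname{id}$ for all $g\in G$, i.e., $\ker(\operatorname{Ad})=G$; (b) $G$ does not have an abelian non-trivial subnormal subgroup; (c) $G$ has a discrete normal subgroup $K$ such that $G/K\cong\mathbb{Q}_p$ (as $p$-adic Lie groups), whence $K=\ker(\psi)$ for some analytic homomorphism $\psi\colon G\to \mathrm{GL}_2(\mathbb{Q}_p)$; and (d) the commutator group $G'$ is discrete.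
   Context: $\mathbb{N}_0=\{0,1,2,\dots\}$. For groups $A_1,A_2$ with a common subgroup $B$, $A_1*_BA_2$ denotes the free product of $A_1$ and $A_2$ with amalgamated subgroup $B$ (the pushout of the inclusions $B\to A_1$, $B\to A_2$ in the category of groups); $A_1$ and $A_2$ are regarded as subgroups of it, with $A_1\cap A_2=B$. The iterated amalgamated products are defined recursively: $G_0:=\mathbb{Q}_p$ (additive group), and for $n\ge 1$, $G_n:=G_{n-1}*_{p^{n-1}\mathbb{Z}_p}\mathbb{Q}_p$, where the new factor is a further copy of $\mathbb{Q}_p$, and $p^{n-1}\mathbb{Z}_p$ is a subgroup of the new factor in the obvious way and a subgroup of $G_{n-1}$ via its inclusion in the last copy of $\mathbb{Q}_p$ used in forming $G_{n-1}$ (for $n=1$: in $G_0=\mathbb{Q}_p$). Thus $G_{n+1}=\mathbb{Q}_p*_{\mathbb{Z}_p}\mathbb{Q}_p*_{p\mathbb{Z}_p}\cdots*_{p^n\mathbb{Z}_p}\mathbb{Q}_p$, $G_0\subseteq G_1\subseteq\cdots$, and $G=\bigcup_{n}G_n$ (direct limit). $p$-adic Lie groups are finite-dimensional analytic Lie groups over $\mathbb{Q}_p$; $\operatorname{Ad}\colon G\to\operatorname{Aut}(\mathfrak{g})$ is the adjoint representation on the Lie algebra $\mathfrak{g}$ of $G$. A subgroup $S$ of a group $G$ is subnormal if there is a finite chain $S=S_m\lhd S_{m-1}\lhd\cdots\lhd S_0=G$ with each term normal in the next larger one. $G'$ is the subgroup generated by all commutators $ghg^{-1}h^{-1}$, $g,h\in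 G$. A subgroup is called discrete if it is discrete in the induced topology. *)

(* Defs.v *)
From HB Require Import structures.
From mathcomp Require Import all_boot all_order all_algebra.
From mathcomp Require Import all_classical topology.

Set Implicit Arguments.
Unset Strict Implicit.
Unset Printing Implicit Defensive.

Import Order.TTheory GRing.Theory Num.Theory.

Local Open Scope quotient_scope.
Local Open Scope classical_set_scope.
Local Open Scope ring_scope.

(* Z_p as the inverse limit of the rings Z/p^n: [residue x n] is the
   representative of x modulo p^n in {0, ..., p^n - 1}. *)
Record padic_int (p : nat) (p_pr : prime p) := PadicInt {
  residue :> nat -> nat;
  residueP : `[< forall n, (residue n < p ^ n)%N /\
                           (residue n.+1 = residue n %[mod p ^ n])%N >] }.

Section PadicIntegers.
Variables (p : nat) (p_pr : prime p).
Local Notation padic_int := (padic_int p_pr).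

HB.instance Definition _ := [isSub of padic_int for @residue p p_pr].
HB.instance Definition _ := [Choice of padic_int by <:].

Let q n : (0 < p ^ n)%N. Proof. by rewrite expn_gt0 prime_gt0. Qed.

Lemma residue_lt (x : padic_int) n : (x n < p ^ n)%N.
Proof. by case: x => x /= /asboolP /(_ n) []. Qed.

Lemma residue_mod (x : padic_int) n k : (x (n + k) %% p ^ n = x n)%N.
Proof.
elim: k => [|k IH]; first by rewrite addn0 modn_small ?residue_lt.
have [_] : (x (n + k) < p ^ (n + k))%N /\
  (x (n + k).+1 = x (n + k) %[mod p ^ (n + k)])%N.
  by case: (x) => y /= /asboolP.
move=> /(congr1 (modn^~ (p ^ n)%N)).
by rewrite !modn_dvdm ?dvdn_exp2l ?leq_addr// addnS IH.
Qed.

Lemma padic_int_eq (x y : padic_int) : (forall n, x n = y n) -> x = y.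
Proof. by move=> xy; apply/val_inj/funext. Qed.

Lemma padic_of_subproof (f : nat -> nat) :
  (forall n, f n.+1 = f n %[mod p ^ n])%N ->
  `[< forall n, (f n %% p ^ n < p ^ n)%N /\
                (f n.+1 %% p ^ n.+1 = f n %% p ^ n %[mod p ^ n])%N >].
Proof.
move=> ff; apply/asboolP => n; rewrite ltn_pmod//; split=> //.
by rewrite modn_dvdm ?dvdn_exp2l// modn_mod ff.
Qed.

Definition padic_of f ff : padic_int := @PadicInt p p_pr _ (@padic_of_subproof f ff).

Lemma residueS (x : padic_int) n : (x n.+1 = x n %[mod p ^ n])%N.
Proof. by case: x => x /= /asboolP /(_ n) []. Qed.

Fact const_subproof k n : (k = k %[mod p ^ n])%N. Proof. by []. Qed.
Fact add_subproof (x y : padic_int) n :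
  (x n.+1 + y n.+1 = x n + y n %[mod p ^ n])%N.
Proof. by rewrite -modnDm !residueS modnDm. Qed.
Fact mul_subproof (x y : padic_int) n :
  (x n.+1 * y n.+1 = x n * y n %[mod p ^ n])%N.
Proof. by rewrite -modnMm !residueS modnMm. Qed.
Fact opp_subproof (x : padic_int) n :
  (p ^ n.+1 - x n.+1 = p ^ n - x n %[mod p ^ n])%N.
Proof.
apply/eqP; rewrite -(eqn_modDr (x n)) subnK ?(ltnW (residue_lt _ _))//.
rewrite -modnDmr -residueS modnDmr subnK ?(ltnW (residue_lt _ _))//.
by rewrite expnS modnMl modnn.
Qed.

Definition padic_int_nat k := padic_of (const_subproof k).
Definition padic_int_add x y := padic_of (add_subproof x y).
Definition padic_int_mul x y := padic_of (mul_subproof x y).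
Definition padic_int_opp x := padic_of (opp_subproof x).

Fact padic_int_addA : associative padic_int_add.
Proof. by move=> x y z; apply/padic_int_eq => n /=; rewrite modnDml modnDmr addnA. Qed.
Fact padic_int_addC : commutative padic_int_add.
Proof. by move=> x y; apply/padic_int_eq => n /=; rewrite addnC. Qed.
Fact padic_int_add0 : left_id (padic_int_nat 0) padic_int_add.
Proof.
by move=> x; apply/padic_int_eq => n /=; rewrite mod0n modn_small// residue_lt.
Qed.
Fact padic_int_addN : left_inverse (padic_int_nat 0) padic_int_opp padic_int_add.
Proof.
move=> x; apply/padic_int_eq => n /=.
by rewrite modnDml subnK ?(ltnW (residue_lt _ _))// modnn mod0n.
Qed.
Fact padic_int_mulA : associative padic_int_mul.
Proof. by move=> x y z; apply/padic_int_eq => n /=; rewrite modnMml modnMmr mulnA. Qed.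
Fact padic_int_mulC : commutative padic_int_mul.
Proof. by move=> x y; apply/padic_int_eq => n /=; rewrite mulnC. Qed.
Fact padic_int_mul1 : left_id (padic_int_nat 1) padic_int_mul.
Proof.
move=> x; apply/padic_int_eq => n /=.
by rewrite modnMml mul1n modn_small// residue_lt.
Qed.
Fact padic_int_mulDl : left_distributive padic_int_mul padic_int_add.
Proof.
by move=> x y z; apply/padic_int_eq => n /=; rewrite modnMml modnDm mulnDl.
Qed.
Fact padic_int_1neq0 : padic_int_nat 1 != padic_int_nat 0.
Proof.
apply/eqP => /(congr1 (fun x : padic_int => x 1%N)) /=.
by rewrite expn1 mod0n modn_small ?prime_gt1.
Qed.

HB.instance Definition _ := GRing.isZmodule.Build padic_int
  padic_int_addA padic_int_addC padic_int_add0 padic_int_addN.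
HB.instance Definition _ := GRing.Zmodule_isComNzRing.Build padic_int
  padic_int_mulA padic_int_mulC padic_int_mul1 padic_int_mulDl padic_int_1neq0.

Lemma residueD (x y : padic_int) n : (x + y) n = ((x n + y n) %% p ^ n)%N.
Proof. by []. Qed.
Lemma residueM (x y : padic_int) n : (x * y) n = ((x n * y n) %% p ^ n)%N.
Proof. by []. Qed.
Lemma residue0 n : (0 : padic_int) n = 0%N.
Proof. exact: mod0n. Qed.

Lemma padic_int_neq0P (x : padic_int) : reflect (exists n, x n != 0)%N (x != 0).
Proof.
apply: (iffP idP) => [x0|[n xn]]; last first.
  by apply: contra_neq xn => ->; rewrite residue0.
apply: contrapT => /forallNP H; move/eqP: x0; apply.
by apply/padic_int_eq => n; rewrite residue0; apply/eqP/negPn/negP/H.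
Qed.

(* |x| = p^(-v), where v + 1 is the first n such that x is nonzero mod p^n. *)
Definition padic_int_abs (x : padic_int) : rat :=
  if pselect (exists n, x n != 0)%N is left h
  then p%:R ^- (ex_minn h).-1 else 0.

Let pQ : 0 < (p%:R : rat). Proof. by rewrite ltr0n prime_gt0. Qed.

Lemma padic_int_absP (x : padic_int) : x != 0 ->
  exists2 v, padic_int_abs x = p%:R ^- v &
    forall N, (v < N)%N -> (0 < x N)%N /\ logn p (x N) = v.
Proof.
move=> /padic_int_neq0P x0; rewrite /padic_int_abs; case: pselect => // h.
case: ex_minnP => m xm mP; exists m.-1 => // N mN.
have m0 : (0 < m)%N.
  by case: m xm mN {mP} => // /eqP[]; have := residue_lt x 0; rewrite expn0; case: (x 0%N).
have mN' : (m <= N)%N by rewrite -(prednK m0).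
have E k : (k <= N)%N -> (x N %% p ^ k = x k)%N by move=> /subnKC <-; rewrite residue_mod.
have xN : (0 < x N)%N.
  by rewrite lt0n; apply: contra_neq xm => xN; rewrite -(E m)// xN mod0n.
split=> //; apply/eqP; rewrite eqn_leq; apply/andP; split.
  rewrite -ltnS prednK// ltnNge -pfactor_dvdn// /dvdn E//.
rewrite -pfactor_dvdn// /dvdn E; last by rewrite (leq_trans (leq_pred _)).
apply/negPn/negP => /mP; rewrite leqNgt prednK//.
by rewrite leqnn.
Qed.

Lemma padic_int_abs0 : padic_int_abs 0 = 0.
Proof.
rewrite /padic_int_abs; case: pselect => // h; exfalso.
by case: h => n; rewrite residue0.
Qed.

Lemma padic_int_mul_neq0 (x y : padic_int) : x != 0 -> y != 0 ->
  x * y != 0 /\ padic_int_abs (x * y) = padic_int_abs x * padic_int_abs y.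
Proof.
move=> x0 y0; have [a -> aP] := padic_int_absP x0.
have [b -> bP] := padic_int_absP y0.
have H N : (a + b < N)%N -> (0 < (x * y)%R N)%N /\ logn p ((x * y)%R N) = (a + b)%N.
  move=> abN.
  have [xN xv] := aP N (leq_ltn_trans (leq_addr _ _) abN).
  have [yN yv] := bP N (leq_ltn_trans (leq_addl _ _) abN).
  have L : logn p (x N * y N)%N = (a + b)%N by rewrite lognM// xv yv.
  have D k : (k <= N)%N -> (p ^ k %| (x * y)%R N)%N = (p ^ k %| x N * y N)%N.
    by move=> kN; rewrite residueM /dvdn modn_dvdm ?dvdn_exp2l.
  have xyN : (0 < (x * y)%R N)%N.
    rewrite lt0n; apply: contraL abN => /eqP xy0.
    have := D N (leqnn _); rewrite xy0 dvdn0 pfactor_dvdn ?muln_gt0 ?xN//.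
    by rewrite L -leqNgt => <-.
  split=> //; apply/eqP; rewrite eqn_leq; apply/andP; split.
    rewrite -ltnS ltnNge -pfactor_dvdn// D// pfactor_dvdn ?muln_gt0 ?xN// L.
    by rewrite ltnn.
  by rewrite -pfactor_dvdn// D 1?ltnW// pfactor_dvdn ?muln_gt0 ?xN// L.
have xy0 : x * y != 0.
  apply/padic_int_neq0P; exists (a + b).+1; rewrite -lt0n.
  by have [] := H _ (leqnn _).
split=> //; have [c -> cP] := padic_int_absP xy0.
have [_ c1] := cP (a + b + c).+1 ltac:(by rewrite ltnS leq_addl).
have [_ c2] := H (a + b + c).+1 ltac:(by rewrite ltnS leq_addr).
by rewrite -invfM -exprD -c2 c1.
Qed.

Fact padic_int_idomain (x y : padic_int) : x * y = 0 -> (x == 0) || (y == 0).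
Proof.
move=> xy; case: eqVneq => //= x0; case: eqVneq => //= y0.
by have [/eqP] := padic_int_mul_neq0 x0 y0.
Qed.

Definition padic_int_unit : {pred padic_int} :=
  fun x => `[< exists y, y * x = 1 >].
Definition padic_int_inv (x : padic_int) := xget x [set y | y * x = 1].

Fact padic_int_mulVr : {in padic_int_unit, left_inverse 1 padic_int_inv *%R}.
Proof.
by move=> x /asboolP[y yx]; rewrite /padic_int_inv; case: xgetP => // /(_ y).
Qed.
Fact padic_int_unitP x y : y * x = 1 -> padic_int_unit x.
Proof. by move=> yx; apply/asboolP; exists y. Qed.
Fact padic_int_invr_out : {in [predC padic_int_unit], padic_int_inv =1 id}.
Proof.
move=> x /negP xU; rewrite /padic_int_inv; case: xgetP => // y _ yx.
by case: xU; apply/asboolP; exists y.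
Qed.

HB.instance Definition _ := GRing.ComNzRing_hasMulInverse.Build padic_int
  padic_int_mulVr padic_int_unitP padic_int_invr_out.
HB.instance Definition _ :=
  GRing.ComUnitRing_isIntegral.Build padic_int padic_int_idomain.

Lemma padic_int_absM (x y : padic_int) :
  padic_int_abs (x * y) = padic_int_abs x * padic_int_abs y.
Proof.
have [->|x0] := eqVneq x 0; first by rewrite mul0r padic_int_abs0 mul0r.
have [->|y0] := eqVneq y 0; first by rewrite mulr0 padic_int_abs0 mulr0.
by have [] := padic_int_mul_neq0 x0 y0.
Qed.

Lemma padic_int_abs_ge0 x : 0 <= padic_int_abs x.
Proof.
have [->|/padic_int_absP[v -> _]] := eqVneq x 0; first by rewrite padic_int_abs0.
by rewrite invr_ge0 exprn_ge0 ?ltW.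
Qed.

Lemma padic_int_abs_eq0 x : (padic_int_abs x == 0) = (x == 0).
Proof.
have [->|/padic_int_absP[v -> _]] := eqVneq x 0; first by rewrite padic_int_abs0 eqxx.
by rewrite invr_eq0 expf_eq0 (gt_eqF pQ) andbF.
Qed.

Lemma padic_int_absN x : padic_int_abs (- x) = padic_int_abs x.
Proof.
have N1 : padic_int_abs (-1) = 1.
  apply/eqP; rewrite -(@eqrXn2 _ 2) ?padic_int_abs_ge0// expr1n.
  rewrite expr2 -padic_int_absM mulrNN mulr1.
  have n0 : padic_int_abs 1 != 0 by rewrite padic_int_abs_eq0 oner_neq0.
  by rewrite -(inj_eq (mulfI n0)) -padic_int_absM !mulr1.
by rewrite -mulN1r padic_int_absM N1 mul1r.
Qed.

Lemma padic_int_absD x y : padic_int_abs (x + y) <=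
  Num.max (padic_int_abs x) (padic_int_abs y).
Proof.
have [->|x0] := eqVneq x 0; first by rewrite add0r le_max lexx orbT.
have [->|y0] := eqVneq y 0; first by rewrite addr0 le_max lexx.
have [->|z0] := eqVneq (x + y) 0.
  by rewrite padic_int_abs0 le_max padic_int_abs_ge0.
have [a -> aP] := padic_int_absP x0; have [b -> bP] := padic_int_absP y0.
have [c -> cP] := padic_int_absP z0.
have p1 : 1 <= (p%:R : rat) by rewrite ler1n prime_gt0.
suff : (minn a b <= c)%N.
  rewrite geq_min le_max !lef_pV2 ?posrE ?exprn_gt0//.
  by case/orP => H; apply/orP; [left|right]; apply: ler_weXn2l.
pose N := (a + b + c).+1.
have [xN xv] : _ /\ _ := aP N ltac:(by rewrite ltnS -addnA leq_addr).
have [yN yv] : _ /\ _ := bP N ltac:(by rewrite ltnS addnAC leq_addl).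
have [zN zv] : _ /\ _ := cP N ltac:(by rewrite ltnS leq_addl).
rewrite -zv -pfactor_dvdn// residueD /dvdn modn_dvdm; last first.
  by rewrite dvdn_exp2l// geq_min /N -addnS -addnA leq_addr.
apply: dvdn_add; rewrite pfactor_dvdn ?xv ?yv ?geq_minl ?geq_minr//.
Qed.

End PadicIntegers.

Section PadicField.
Variables (p : nat) (p_pr : prime p).

Definition padic := {fraction padic_int p_pr}.
HB.instance Definition _ := GRing.Field.on padic.

Definition padic_of_int (a : padic_int p_pr) : padic := FracField.tofrac a.

Fact padic_of_intD : {morph padic_of_int : x y / x + y}.
Proof. exact: tofracD. Qed.
Fact padic_of_intB : {morph padic_of_int : x y / x - y}.
Proof. exact: tofracB. Qed.
Fact padic_of_intN : {morph padic_of_int : x / - x}.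
Proof. exact: tofracN. Qed.
Fact padic_of_intM : {morph padic_of_int : x y / x * y}.
Proof. exact: tofracM. Qed.
Fact padic_of_int_eq0 a : (padic_of_int a == 0) = (a == 0).
Proof. exact: tofrac_eq0. Qed.
Fact padic_of_int_inj : injective padic_of_int.
Proof. by move=> a b /eqP; rewrite /padic_of_int tofrac_eq => /eqP. Qed.

Definition padic_abs (x : padic) : rat :=
  padic_int_abs \n_(repr x) / padic_int_abs \d_(repr x).

Lemma padic_fracE (x : padic) :
  x = padic_of_int \n_(repr x) / padic_of_int \d_(repr x).
Proof.
rewrite -[LHS]reprK -[repr x in LHS]Ratio_numden /padic_of_int.
unlock FracField.tofrac.
rewrite -[X in _ = _ * X]FracField.pi_inv -[RHS]FracField.pi_mul.
rewrite /FracField.mulf /FracField.invf /=.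
by rewrite !numden_Ratio ?(oner_neq0, mul1r, mulr1)// denom_ratioP.
Qed.

Lemma padic_fracP (x : padic) : exists2 ab : padic_int p_pr * padic_int p_pr,
  ab.2 != 0 & x = padic_of_int ab.1 / padic_of_int ab.2.
Proof.
exists (\n_(repr x), \d_(repr x)); last exact: padic_fracE.
exact: denom_ratioP.
Qed.

Lemma padic_abs_frac (a b : padic_int p_pr) : b != 0 ->
  padic_abs (padic_of_int a / padic_of_int b) =
  padic_int_abs a / padic_int_abs b.
Proof.
move=> b0; rewrite /padic_abs; set y := padic_of_int a / _.
have d0 : \d_(repr y) != 0 by apply: denom_ratioP.
have /(congr1 (@padic_int_abs p p_pr)) : \n_(repr y) * b = a * \d_(repr y).
  apply/padic_of_int_inj; rewrite !padic_of_intM; apply/eqP.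
  by rewrite -eqr_div ?padic_of_int_eq0// -padic_fracE.
rewrite !padic_int_absM => E.
by apply/eqP; rewrite eqr_div ?padic_int_abs_eq0//; apply/eqP.
Qed.

Lemma padic_absM : {morph padic_abs : x y / x * y}.
Proof.
move=> x y; have [[a b] /= b0 ->] := padic_fracP x.
have [[c d] /= d0 ->] := padic_fracP y.
rewrite mulf_div -!padic_of_intM !padic_abs_frac ?mulf_neq0//.
by rewrite !padic_int_absM mulf_div.
Qed.

Lemma padic_abs_ge0 x : 0 <= padic_abs x.
Proof. by rewrite divr_ge0 ?padic_int_abs_ge0. Qed.

Lemma padic_abs_eq0 x : (padic_abs x == 0) = (x == 0).
Proof.
have [[a b] /= b0 ->] := padic_fracP x; rewrite padic_abs_frac//.
rewrite !mulf_eq0 !invr_eq0 !padic_of_int_eq0.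
by rewrite !padic_int_abs_eq0.
Qed.

Lemma padic_absN x : padic_abs (- x) = padic_abs x.
Proof.
have [[a b] /= b0 ->] := padic_fracP x.
by rewrite -mulNr -padic_of_intN !padic_abs_frac// padic_int_absN.
Qed.

Lemma padic_absD x y : padic_abs (x + y) <= Num.max (padic_abs x) (padic_abs y).
Proof.
have [[a b] /= b0 ->] := padic_fracP x.
have [[c d] /= d0 ->] := padic_fracP y.
have bd0 : 0 < padic_int_abs b * padic_int_abs d.
  by rewrite mulr_gt0// lt0r padic_int_abs_eq0 padic_int_abs_ge0 ?b0 ?d0.
rewrite addf_div ?padic_of_int_eq0// -!padic_of_intM -padic_of_intD.
rewrite !padic_abs_frac ?mulf_neq0// padic_int_absM ler_pdivrMr//.
apply: le_trans (padic_int_absD _ _) _; rewrite maxr_pMl ?(ltW bd0)//.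
have -> : padic_int_abs a / padic_int_abs b * (padic_int_abs b * padic_int_abs d)
  = padic_int_abs (a * d).
  by rewrite mulrA divfK ?padic_int_abs_eq0// padic_int_absM.
have -> // : padic_int_abs c / padic_int_abs d * (padic_int_abs b * padic_int_abs d)
  = padic_int_abs (c * b).
by rewrite [X in _ * X]mulrC mulrA divfK ?padic_int_abs_eq0// padic_int_absM.
Qed.

Definition padic_dist (x y : padic) : rat := padic_abs (x - y).

Fact padic_dist_xx x : padic_dist x x = 0.
Proof. by apply/eqP; rewrite padic_abs_eq0 subrr. Qed.
Fact padic_dist_pos x y : padic_dist x y = 0 -> x = y.
Proof. by move=> /eqP; rewrite padic_abs_eq0 subr_eq0 => /eqP. Qed.
Fact padic_dist_sym x y : padic_dist x y = padic_dist y x.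
Proof. by rewrite /padic_dist -padic_absN opprB. Qed.
Fact padic_dist_triangle y x z :
  padic_dist x z <= padic_dist x y + padic_dist y z.
Proof.
rewrite /padic_dist -[x - z](subrKA y) (le_trans (padic_absD _ _))// ge_max.
by rewrite lerDl lerDr !padic_abs_ge0.
Qed.

HB.instance Definition _ := isMetric.Build rat padic
  padic_dist_xx padic_dist_pos padic_dist_sym padic_dist_triangle.

End PadicField.

(* The group generated by the disjoint union of the groups A i, subject to the
   relations of the A i and to x = y whenever R x y; it is the colimit in groups
   of the A i along R (glued_inR, glued_rec). *)
Section GluedGroup.
Local Open Scope group_scope.
Variables (I : choiceType) (A : I -> groupType).
Variable (R : {i : I & A i} -> {i : I & A i} -> Prop).

Notation word := (seq {i : I & A i}).
Notation letter i x := (@Tagged _ i (fun j => A j : Type) x).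

Inductive word_eq : word -> word -> Prop :=
| word_refl u : word_eq u u
| word_sym u v : word_eq u v -> word_eq v u
| word_trans u v w : word_eq u v -> word_eq v w -> word_eq u w
| word_cat u v u' v' : word_eq u v -> word_eq u' v' ->
    word_eq (u ++ u') (v ++ v')
| word_one i : word_eq [:: letter i 1] [::]
| word_mul i (x y : A i) :
    word_eq [:: letter i x; letter i y] [:: letter i (x * y)]
| word_glue x y : R x y -> word_eq [:: x] [:: y].

Definition word_eqb (u v : word) := `[< word_eq u v >].

Fact word_eqb_refl : reflexive word_eqb.
Proof. by move=> u; apply/asboolP/word_refl. Qed.
Fact word_eqb_sym : symmetric word_eqb.
Proof. by move=> u v; apply/asboolP/asboolP => /word_sym. Qed.
Fact word_eqb_trans : transitive word_eqb.
Proof.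
by move=> v u w /asboolP uv /asboolP vw; apply/asboolP/(word_trans uv).
Qed.

Canonical word_equiv :=
  EquivRel word_eqb word_eqb_refl word_eqb_sym word_eqb_trans.

Definition glued_group := {eq_quot word_eqb}.
HB.instance Definition _ := Choice.on glued_group.


Definition gluedW (w : word) : glued_group := \pi_{eq_quot word_eqb} w.

Definition glued_mul (x y : glued_group) : glued_group := gluedW (repr x ++ repr y).
Definition glued_one : glued_group := gluedW [::].
Definition inv_letter (a : {i : I & A i}) := letter (tag a) (tagged a)^-1.
Definition inv_word (w : word) : word := rev (map inv_letter w).
Definition glued_inv (x : glued_group) : glued_group := gluedW (inv_word (repr x)).

Lemma gluedW_eq u v : word_eq u v <-> gluedW u = gluedW v.
Proof.
split=> [uv|/eqmodP/asboolP//]; by apply/eqmodP/asboolP.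
Qed.

Lemma gluedW_repr (x : glued_group) : gluedW (repr x) = x. Proof. exact: reprK. Qed.

Lemma gluedWP (x : glued_group) : exists w, x = gluedW w.
Proof. by exists (repr x); rewrite gluedW_repr. Qed.

Lemma glued_mulE u v : glued_mul (gluedW u) (gluedW v) = gluedW (u ++ v).
Proof. by apply/gluedW_eq/word_cat; apply/gluedW_eq; rewrite gluedW_repr. Qed.

Fact glued_mulA : associative glued_mul.
Proof.
move=> x y z; have [u ->] := gluedWP x; have [v ->] := gluedWP y.
by have [w ->] := gluedWP z; rewrite !glued_mulE catA.
Qed.
Fact glued_mul1 : left_id glued_one glued_mul.
Proof. by move=> x; have [u ->] := gluedWP x; rewrite glued_mulE. Qed.
Fact glued_mulr1 : right_id glued_one glued_mul.
Proof. by move=> x; have [u ->] := gluedWP x; rewrite glued_mulE cats0. Qed.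

Lemma inv_wordl w : word_eq (inv_word w ++ w) [::].
Proof.
elim: w => [|[i x] w IH]; first exact: word_refl.
rewrite /inv_word/= rev_cons -cats1 -catA/= /inv_letter/=.
apply: word_trans IH; apply: word_cat; first exact: word_refl.
rewrite -[letter i x :: w]/([:: letter i x] ++ w) -cat1s catA/=.
rewrite -[X in word_eq _ X]/([::] ++ w).
rewrite -[X in word_eq X _]/([:: letter i x^-1; letter i x] ++ w).
apply: word_cat; last exact: word_refl.
by apply: word_trans (word_mul _ _) _; rewrite mulVg; apply: word_one.
Qed.

Lemma inv_wordr w : word_eq (w ++ inv_word w) [::].
Proof.
suff wK : inv_word (inv_word w) = w by rewrite -{1}wK; apply: inv_wordl.
rewrite /inv_word map_rev revK -map_comp -[RHS]map_id; apply: eq_map.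
by case=> i x; rewrite /inv_letter/= invgK.
Qed.

Fact glued_mulV : left_inverse glued_one glued_inv glued_mul.
Proof.
by move=> x; rewrite -{2}[x]gluedW_repr glued_mulE; apply/gluedW_eq/inv_wordl.
Qed.
Fact glued_mulrV : right_inverse glued_one glued_inv glued_mul.
Proof.
by move=> x; rewrite -{1}[x]gluedW_repr glued_mulE; apply/gluedW_eq/inv_wordr.
Qed.

HB.instance Definition _ := isGroup.Build glued_group
  glued_mulA glued_mul1 glued_mulr1 glued_mulV glued_mulrV.

Definition glued_in i (x : A i) : glued_group := gluedW [:: letter i x].

Fact glued_inM i : {morph @glued_in i : x y / x * y}.
Proof.
move=> x y; rewrite [RHS]glued_mulE; apply/esym/gluedW_eq; exact: word_mul.
Qed.

HB.instance Definition _ i :=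
  isMultiplicative.Build (A i) glued_group (@glued_in i) (@glued_inM i).

Lemma glued_inR x y : R x y -> glued_in (tagged x) = glued_in (tagged y).
Proof.
by case: x y => [i x] [j y] xy; apply/gluedW_eq/word_glue.
Qed.

Lemma multiplicative1 (H K : groupType) (f : {multiplicative H -> K}) : f 1 = 1.
Proof. by apply: (mulgI (f 1)); rewrite -gmulfM !mulg1. Qed.

Lemma glued_rec (H : groupType) (f : forall i, {multiplicative A i -> H}) :
  (forall x y, R x y -> f _ (tagged x) = f _ (tagged y)) ->
  exists h : {multiplicative glued_group -> H},
    (forall i x, h (@glued_in i x) = f i x) /\
    forall h' : {multiplicative glued_group -> H},
      (forall i x, h' (@glued_in i x) = f i x) -> h' =1 h.
Proof.
move=> fR; pose ev (w : word) : H := \prod_(a <- w) f _ (tagged a).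
have evP u v : word_eq u v -> ev u = ev v.
  elim=> //; rewrite /ev.
  - by move=> ? ? ? _ -> _ ->.
  - by move=> ? ? ? ? _ uv _ uv'; rewrite !big_cat /= uv uv'.
  - by move=> i; rewrite big_seq1 big_nil multiplicative1.
  - by move=> i x y; rewrite big_cons !big_seq1 gmulfM.
  - by move=> x y xy; rewrite !big_seq1; exact: fR.
pose h (x : glued_group) := ev (repr x).
have hE w : h (gluedW w) = ev w by apply/evP/gluedW_eq; rewrite gluedW_repr.
have hM : {morph h : x y / x * y}.
  move=> x y; have [u ->] := gluedWP x; have [v ->] := gluedWP y.
  by rewrite [X in h X]glued_mulE !hE /ev big_cat.
pose hh : {multiplicative _ -> _} :=
   HB.pack h (isMultiplicative.Build _ _ h hM).
exists hh; split=> [i x|g gE x]; first by rewrite /= hE /ev big_seq1.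
have [w ->] := gluedWP x; rewrite /= hE {x}.
elim: w => [|[i x] w IH]; first by rewrite /ev big_nil; apply: multiplicative1.
rewrite -[_ :: w]/([:: letter i x] ++ w) -glued_mulE [LHS]gmulfM IH.
by rewrite [X in X * _]gE /ev big_cat /= big_seq1.
Qed.
End GluedGroup.

(* A1 *_B A2, for maps f1 : B -> A1 and f2 : B -> A2 (pushout: amalgam_square,
   amalgam_pushout). *)
Section Amalgam.
Local Open Scope group_scope.
Variables (B A1 A2 : groupType).
Variables (f1 : {multiplicative B -> A1}) (f2 : {multiplicative B -> A2}).

Definition amalgam_factor (s : bool) : groupType := if s then A2 else A1.

Inductive amalgam_glue :
    {s : bool & amalgam_factor s} -> {s : bool & amalgam_factor s} -> Prop :=
| AmalgamGlue (b : B) :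
    amalgam_glue (existT _ false (f1 b)) (existT _ true (f2 b)).

Definition amalgam : groupType := glued_group amalgam_glue.

Definition amalgam_inl : {multiplicative A1 -> amalgam} :=
  (@glued_in _ amalgam_factor amalgam_glue false :
    {multiplicative amalgam_factor false -> glued_group amalgam_glue}).
Definition amalgam_inr : {multiplicative A2 -> amalgam} :=
  (@glued_in _ amalgam_factor amalgam_glue true :
    {multiplicative amalgam_factor true -> glued_group amalgam_glue}).

Lemma amalgam_square b : amalgam_inl (f1 b) = amalgam_inr (f2 b).
Proof.
exact: (glued_inR (AmalgamGlue b)).
Qed.

Lemma amalgam_pushout (H : groupType)
    (g1 : {multiplicative A1 -> H}) (g2 : {multiplicative A2 -> H}) :
  (forall b, g1 (f1 b) = g2 (f2 b)) ->
  exists h : {multiplicative amalgam -> H},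
    [/\ forall x, h (amalgam_inl x) = g1 x,
        forall x, h (amalgam_inr x) = g2 x &
        forall h' : {multiplicative amalgam -> H},
          (forall x, h' (amalgam_inl x) = g1 x) ->
          (forall x, h' (amalgam_inr x) = g2 x) -> h' =1 h].
Proof.
move=> g12; pose f (s : bool) : {multiplicative amalgam_factor s -> H} :=
  if s as s0 return {multiplicative amalgam_factor s0 -> H} then g2 else g1.
have [|h [hf hU]] := @glued_rec _ amalgam_factor amalgam_glue H f.
  by move=> _ _ [b] /=.
exists h; split; [exact: (hf false)|exact: (hf true)|].
by move=> h' h1 h2; apply: hU => -[].
Qed.

End Amalgam.

(* Direct limit of A 0 -> A 1 -> ...; every element comes from some A n
   (union_inP). *)
Section SequentialUnion.
Local Open Scope group_scope.
Variables (A : nat -> groupType) (j : forall n, {multiplicative A n -> A n.+1}).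

Inductive union_glue : {n : nat & A n} -> {n : nat & A n} -> Prop :=
| UnionGlue n (a : A n) : union_glue (existT _ n a) (existT _ n.+1 (j n a)).

Definition union_group : groupType := glued_group union_glue.

Definition union_in n : {multiplicative A n -> union_group} :=
  (@glued_in _ A union_glue n : {multiplicative A n -> glued_group union_glue}).

Lemma union_inS n (a : A n) : union_in n.+1 (j n a) = union_in n a.
Proof.
exact/esym/(glued_inR (UnionGlue a)).
Qed.

Lemma union_rec (H : groupType) (f : forall n, {multiplicative A n -> H}) :
  (forall n a, f n.+1 (j n a) = f n a) ->
  exists h : {multiplicative union_group -> H},
    (forall n a, h (union_in n a) = f n a) /\
    forall h' : {multiplicative union_group -> H},
      (forall n a, h' (union_in n a) = f n a) -> h' =1 h.
Proof.
by move=> fj; apply: glued_rec => _ _ [n a] /=; rewrite fj.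
Qed.

Lemma union_in_le m n (x : A m) : (m <= n)%N -> exists y, union_in n y = union_in m x.
Proof.
elim: n => [|n IH]; first by rewrite leqn0 => /eqP m0; subst m; exists x.
rewrite leq_eqVlt => /predU1P[mn|/IH[y <-]]; first by subst m; exists x.
by exists (j n y); rewrite union_inS.
Qed.

Lemma union_inP (x : union_group) : exists n (a : A n), x = union_in n a.
Proof.
have [w ->] := gluedWP x; elim: w => [|[m a] w [n [b wb]]].
  by exists 0%N, 1; rewrite multiplicative1.
rewrite -[_ :: w]/([:: Tagged (fun n => A n : Type) a] ++ w) -glued_mulE wb.
have [a' a'E] := union_in_le a (leq_maxl m n).
have [b' b'E] := union_in_le b (leq_maxr m n).
by exists (maxn m n), (a' * b'); rewrite gmulfM a'E b'E.
Qed.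

End SequentialUnion.

Section Tower.
Variables (p : nat) (p_pr : prime p).

Definition padic_group : groupType := Algebra.to_multiplicative (padic p_pr).

(* p^n Z_p *)
Definition ppow_padic_int n : {pred padic p_pr} :=
  fun x => `[< exists a : padic_int p_pr, x = p%:R ^+ n * padic_of_int a >].

Fact ppow_padic_int_closed n : zmod_closed (ppow_padic_int n).
Proof.
split; first by apply/asboolP; exists 0; rewrite /padic_of_int tofrac0 mulr0.
move=> x y /asboolP[a ->] /asboolP[b ->]; apply/asboolP; exists (a - b).
by rewrite padic_of_intB mulrBr.
Qed.

HB.instance Definition _ n := GRing.isZmodClosed.Build (padic p_pr)
  (ppow_padic_int n) (ppow_padic_int_closed n).

Record ppow_int n := PpowInt {
  ppow_val :> padic p_pr; _ : ppow_val \in ppow_padic_int n }.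

HB.instance Definition _ n := [isSub of ppow_int n for @ppow_val n].
HB.instance Definition _ n := [Choice of ppow_int n by <:].
HB.instance Definition _ n := [SubChoice_isSubZmodule of ppow_int n by <:].

Definition ppow_group n : groupType := Algebra.to_multiplicative (ppow_int n).

Definition ppow_incl n (x : ppow_group n) : padic_group := ppow_val x.

Fact ppow_incl_mul n : {morph @ppow_incl n : x y / (x * y)%g}.
Proof. by []. Qed.

HB.instance Definition _ n := isMultiplicative.Build
  (ppow_group n) padic_group (@ppow_incl n) (@ppow_incl_mul n).

(* stage_at n is G_n with the embedding of the last copy of Q_p used to form it;
   G_(n+1) amalgamates G_n and a new copy of Q_p along p^n Z_p. *)
Record stage := Stage {
  stage_group : groupType;
  last_copy : {multiplicative padic_group -> stage_group} }.

Fixpoint stage_at (n : nat) : stage :=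
  if n is m.+1 then
    let S := stage_at m in
    Stage (amalgam_inr (last_copy S \o @ppow_incl m) (@ppow_incl m))
  else Stage (idfun : {multiplicative padic_group -> padic_group}).

Definition iterated_amalgam n : groupType := stage_group (stage_at n).

Definition iterated_incl n :
    {multiplicative iterated_amalgam n -> iterated_amalgam n.+1} :=
  amalgam_inl (last_copy (stage_at n) \o @ppow_incl n) (@ppow_incl n).

Definition amalgam_union : groupType := union_group iterated_incl.

End Tower.

Section NormalSubgroups.
Local Open Scope group_scope.

Section Sub.
Variable G : groupType.
Implicit Types S T : set G.

Definition is_subgroup S :=
  [/\ S 1, forall x y, S x -> S y -> S (x * y) & forall x, S x -> S x^-1].

Definition is_normal_in S T :=
  [/\ is_subgroup S, is_subgroup T, S `<=` T &
      forall g x, T g -> S x -> S (g * x * g^-1)].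

Definition is_subnormal S := exists m (C : nat -> set G),
  [/\ C 0 = setT, C m = S & forall i, (i < m)%N -> is_normal_in (C i.+1) (C i)].

Definition is_abelian S := forall x y, S x -> S y -> x * y = y * x.

Definition commutator_subgroup : set G :=
  \bigcap_(S in [set S | is_subgroup S /\
                         forall g h, S (g * h * g^-1 * h^-1)]) S.

Record normal_subgroup := NormalSubgroup {
  nsub : set G;
  nsubP : is_normal_in nsub setT }.

Variable K : normal_subgroup.

Definition same_coset (x y : G) := `[< nsub K (x^-1 * y) >].

Let K1 : nsub K 1. Proof. by case: (nsubP K) => -[]. Qed.
Let KM x y : nsub K x -> nsub K y -> nsub K (x * y).
Proof. by case: (nsubP K) => -[_ KM _] _ _ _; apply: KM. Qed.
Let KV x : nsub K x -> nsub K x^-1.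
Proof. by case: (nsubP K) => -[_ _ KV] _ _ _; apply: KV. Qed.
Let KJ x g : nsub K x -> nsub K (g * x * g^-1).
Proof. by case: (nsubP K) => _ _ _ KJ; apply: KJ. Qed.

Fact same_coset_refl : reflexive same_coset.
Proof. by move=> x; apply/asboolP; rewrite mulVg. Qed.
Fact same_coset_sym : symmetric same_coset.
Proof.
by move=> x y; apply/asboolP/asboolP => /KV; rewrite invgM invgK.
Qed.
Fact same_coset_trans : transitive same_coset.
Proof.
move=> y x z /asboolP xy /asboolP yz; apply/asboolP.
by have := KM xy yz; rewrite mulgA mulgK.
Qed.

Canonical same_coset_equiv :=
  EquivRel same_coset same_coset_refl same_coset_sym same_coset_trans.

Definition quotient_group := {eq_quot same_coset}.
HB.instance Definition _ := Choice.on quotient_group.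

Definition quotient_map (x : G) : quotient_group := \pi_{eq_quot same_coset} x.

Definition quotient_mul (x y : quotient_group) := quotient_map (repr x * repr y).
Definition quotient_inv (x : quotient_group) := quotient_map (repr x)^-1.

Lemma quotient_mapP x y : quotient_map x = quotient_map y <-> nsub K (x^-1 * y).
Proof. by split=> [/eqmodP/asboolP|xy] //; apply/eqmodP/asboolP. Qed.

Lemma quotient_mapK (x : quotient_group) : quotient_map (repr x) = x.
Proof. exact: reprK. Qed.

Lemma quotient_map_surj (x : quotient_group) : exists y, x = quotient_map y.
Proof. by exists (repr x); rewrite quotient_mapK. Qed.

Lemma quotient_mulE x y :
  quotient_mul (quotient_map x) (quotient_map y) = quotient_map (x * y).
Proof.
set a := quotient_map x; set b := quotient_map y.
have /quotient_mapP xa : quotient_map (repr a) = quotient_map x.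
  exact: quotient_mapK.
have /quotient_mapP yb : quotient_map (repr b) = quotient_map y.
  exact: quotient_mapK.
apply/quotient_mapP; have := KM (KJ (repr b)^-1 xa) yb.
by rewrite invgK invgM !mulgA mulgK.
Qed.

Lemma quotient_invE x : quotient_inv (quotient_map x) = quotient_map x^-1.
Proof.
have /quotient_mapP xa : quotient_map (repr (quotient_map x)) = quotient_map x.
  exact: quotient_mapK.
apply/quotient_mapP; have := KJ x (KV xa).
by rewrite invgM !invgK !mulgA mulgV mul1g.
Qed.

Fact quotient_mulA : associative quotient_mul.
Proof.
move=> x y z; have [a ->] := quotient_map_surj x.
have [b ->] := quotient_map_surj y; have [c ->] := quotient_map_surj z.
by rewrite !quotient_mulE mulgA.
Qed.
Fact quotient_mul1 : left_id (quotient_map 1) quotient_mul.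
Proof. by move=> x; have [a ->] := quotient_map_surj x; rewrite quotient_mulE mul1g. Qed.
Fact quotient_mulr1 : right_id (quotient_map 1) quotient_mul.
Proof. by move=> x; have [a ->] := quotient_map_surj x; rewrite quotient_mulE mulg1. Qed.
Fact quotient_mulV : left_inverse (quotient_map 1) quotient_inv quotient_mul.
Proof.
move=> x; have [a ->] := quotient_map_surj x.
by rewrite quotient_invE quotient_mulE mulVg.
Qed.
Fact quotient_mulrV : right_inverse (quotient_map 1) quotient_inv quotient_mul.
Proof.
move=> x; have [a ->] := quotient_map_surj x.
by rewrite quotient_invE quotient_mulE mulgV.
Qed.

HB.instance Definition _ := isGroup.Build quotient_group
  quotient_mulA quotient_mul1 quotient_mulr1 quotient_mulV quotient_mulrV.

Fact quotient_mapM : {morph quotient_map : x y / x * y}.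
Proof. by move=> x y; rewrite [RHS]quotient_mulE. Qed.

HB.instance Definition _ :=
  isMultiplicative.Build G quotient_group quotient_map quotient_mapM.


End Sub.
End NormalSubgroups.

Section Analytic.
Variables (p : nat) (p_pr : prime p).
Local Notation K := (padic p_pr).

Definition vnorm d (v : 'rV[K]_d) : rat := \big[Num.max/0]_(i < d) padic_abs (v 0 i).

Definition monomial d (h : 'rV[K]_d) (alpha : {ffun 'I_d -> nat}) : K :=
  \prod_(i < d) h 0 i ^+ alpha i.

(* The partial sum over the exponents alpha with alpha i < N for all i. *)
Definition partial_sum m n (c : {ffun 'I_m -> nat} -> 'rV[K]_n) (h : 'rV[K]_m)
    (N : nat) : 'rV[K]_n :=
  \sum_(alpha : {ffun 'I_m -> 'I_N})
    let beta := [ffun i => val (alpha i)] in monomial h beta *: c beta.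

(* f(a + h) is the sum of a power series on some ball |h| < r. The bound on the
   coefficients can always be achieved by shrinking r, and makes the series
   converge unconditionally on that ball. *)
Definition analytic_at m n (f : 'rV[K]_m -> 'rV[K]_n) (a : 'rV[K]_m) : Prop :=
  exists (c : {ffun 'I_m -> nat} -> 'rV[K]_n) (r C : rat),
    [/\ 0 < r,
        forall alpha, vnorm (c alpha) * r ^+ (\sum_i alpha i)%N <= C &
        forall h, vnorm h < r -> partial_sum c h @ \oo --> f (a + h)].

Definition analytic_on m n (D : set 'rV[K]_m) (f : 'rV[K]_m -> 'rV[K]_n) :=
  open D /\ forall a, D a -> analytic_at f a.

(* Vectors are rows: h *m J is the derivative of f at a in the direction h. *)
Definition is_jacobian m n (f : 'rV[K]_m -> 'rV[K]_n) (a : 'rV[K]_m)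
    (J : 'M[K]_(m, n)) : Prop :=
  forall e : rat, 0 < e -> \forall h \near (0 : 'rV[K]_m),
    vnorm (f (a + h) - f a - h *m J) <= e * vnorm h.

Definition jacobian m n (f : 'rV[K]_m -> 'rV[K]_n) (a : 'rV[K]_m) : 'M[K]_(m, n) :=
  xget 0 [set J | is_jacobian f a J].

Lemma le_vnorm d (v : 'rV[K]_d) i : padic_abs (v 0 i) <= vnorm v.
Proof. by rewrite /vnorm (bigD1 i)//= le_max lexx. Qed.

Lemma vnorm_ge0 d (v : 'rV[K]_d) : 0 <= vnorm v.
Proof.
rewrite /vnorm; elim/big_rec: _ => // i x _ x0.
by rewrite le_max x0 orbT.
Qed.

Lemma vnorm_le d (v : 'rV[K]_d) x : 0 <= x ->
  (forall i, padic_abs (v 0 i) <= x) -> vnorm v <= x.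
Proof.
by move=> x0 vx; rewrite /vnorm; elim/big_rec: _ => // i y _ yx; rewrite ge_max vx.
Qed.

Lemma vnormD d (u v : 'rV[K]_d) : vnorm (u + v) <= vnorm u + vnorm v.
Proof.
apply: vnorm_le => [|i]; first by rewrite addr_ge0 ?vnorm_ge0.
rewrite mxE (le_trans (padic_absD _ _))// ge_max.
rewrite (le_trans (le_vnorm u i)) ?(le_trans (le_vnorm v i))//.
  by rewrite lerDr vnorm_ge0.
by rewrite lerDl vnorm_ge0.
Qed.

Lemma vnorm0 d : vnorm (0 : 'rV[K]_d) = 0.
Proof.
apply/eqP; rewrite eq_le vnorm_ge0 andbT; apply: vnorm_le => // i.
by rewrite mxE le_eqVlt padic_abs_eq0 eqxx.
Qed.

Lemma vnorm_natb d (b : bool) (u : 'rV[K]_d) : vnorm (b%:R *: u) <= vnorm u.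
Proof. by case: b; rewrite ?scale1r// scale0r vnorm0 vnorm_ge0. Qed.

Section Affine.
Variables (m n : nat) (f : 'rV[K]_m -> 'rV[K]_n) (A : 'M[K]_(m, n)).
Hypothesis fA : forall a h, f (a + h) = f a + h *m A.

Let idx0 : {ffun 'I_m -> nat} := [ffun=> 0%N].
Let idx1 j : {ffun 'I_m -> nat} := [ffun i => (i == j : nat)].
Let coef a alpha : 'rV[K]_n :=
  (alpha == idx0)%:R *: f a + \sum_j (alpha == idx1 j)%:R *: row j A.

Let pick_coef N (beta : {ffun 'I_m -> nat}) (h : 'rV[K]_m) (v : 'rV[K]_n) :
  (forall i, beta i < N)%N ->
  \sum_(alpha : {ffun 'I_m -> 'I_N})
    monomial h [ffun i => val (alpha i)] *:
      (([ffun i => val (alpha i)] == beta)%:R *: v) = monomial h beta *: v.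
Proof.
move=> betaN; pose b : {ffun 'I_m -> 'I_N} := [ffun i => Ordinal (betaN i)].
have bE : [ffun i => val (b i)] = beta by apply/ffunP => i; rewrite !ffunE.
rewrite (bigD1 b)//= bE eqxx scale1r big1 ?addr0// => a ab.
case: eqP => [ae|_]; last by rewrite scale0r scaler0.
case/eqP: ab; apply/ffunP => i; apply/val_inj; move/ffunP/(_ i): ae.
by rewrite !ffunE.
Qed.

Lemma affine_analytic_at a : analytic_at f a.
Proof.
exists (coef a), 1, (vnorm (f a) + \sum_j vnorm (row j A)); split=> //.
  move=> alpha; rewrite expr1n mulr1 (le_trans (vnormD _ _))// lerD ?vnorm_natb//.
  elim/big_ind2: _ => [|u x v y ux vy|j _]; rewrite ?vnorm0 ?vnorm_natb//.
  by rewrite (le_trans (vnormD _ _))// lerD.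
move=> h _; apply: cvg_near_cst; near=> N.
have N2 : (1 < N)%N by near: N; exact: nbhs_infty_gt.
rewrite /partial_sum /=.
under eq_bigr do rewrite scalerDr scaler_sumr.
rewrite big_split/= exchange_big/= pick_coef; last first.
  by move=> i; rewrite ffunE ltnW.
under eq_bigr => j _.
  rewrite pick_coef; last by move=> i; rewrite ffunE; case: (i == j) => //; exact: ltnW.
  over.
rewrite fA mulmx_sum_row; congr (_ + _).
  by rewrite /monomial big1 ?scale1r// => i _; rewrite ffunE expr0.
apply: eq_bigr => j _; congr (_ *: _).
rewrite /monomial (bigD1 j)//= ffunE eqxx expr1 big1 ?mulr1// => i ij.
by rewrite ffunE (negbTE ij) expr0.
Unshelve. all: by end_near. Qed.

Lemma affine_analytic D : open D -> analytic_on D f.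
Proof. by move=> oD; split=> // a _; exact: affine_analytic_at. Qed.

End Affine.

Lemma rV_hausdorff d : hausdorff_space 'rV[K]_d.
Proof.
move=> u v uv; apply/rowP => i; apply: (@metric_hausdorff rat K) => U V nU nV.
have S (w : 'rV[K]_d) (W : set K) : nbhs (w 0 i) W -> nbhs w [set z | W (z 0 i)].
  move=> nW; exists (fun _ j => if j == i then W else setT) => [k j|z].
    by rewrite ord1; case: eqP => [->|_] //; exact: filterT.
  by move=> /(_ 0 i); rewrite eqxx.
by have [z [zU zV]] := uv _ _ (S u U nU) (S v V nV); exists (z 0 i).
Qed.

End Analytic.

Section Manifolds.
Variables (p : nat) (p_pr : prime p).
Local Notation K := (padic p_pr).

Record chart (d : nat) (M : Type) := Chart {
  chart_dom : set M;
  chart_cod : set 'rV[K]_d;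
  chart_map :> M -> 'rV[K]_d;
  chart_inv : 'rV[K]_d -> M;
  chart_mapP : forall x, chart_dom x -> chart_cod (chart_map x);
  chart_invP : forall y, chart_cod y -> chart_dom (chart_inv y);
  chart_mapK : forall x, chart_dom x -> chart_inv (chart_map x) = x;
  chart_invK : forall y, chart_cod y -> chart_map (chart_inv y) = y;
  chart_cod_open : open chart_cod }.

(* M with the topology for which the charts in A are homeomorphisms onto open
   subsets of K^d. *)
Definition atlas_space d (M : choiceType) (A : set (chart d M)) : Type := M.

Section AtlasTopology.
Variables (d : nat) (M : choiceType) (A : set (chart d M)).
Local Notation atlas_space := (atlas_space A).

HB.instance Definition _ := Choice.copy atlas_space M.

Definition atlas_open (U : set atlas_space) : Prop :=
  forall c, A c -> open (c @` (chart_dom c `&` U)).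

Fact atlas_openT : atlas_open setT.
Proof.
move=> c _; suff -> : c @` (chart_dom c `&` setT) = chart_cod c.
  exact: chart_cod_open.
rewrite setIT; apply/seteqP; split=> [_ [x cx <-]|y cy]; first exact: chart_mapP.
by exists (chart_inv c y); [exact: chart_invP|exact: chart_invK].
Qed.

Fact atlas_openI : setI_closed atlas_open.
Proof.
move=> U V oU oV c Ac; suff -> : c @` (chart_dom c `&` (U `&` V)) =
    c @` (chart_dom c `&` U) `&` c @` (chart_dom c `&` V).
  by apply: openI; [exact: oU|exact: oV].
apply/seteqP; split=> [_ [x [cx [Ux Vx]] <-]|y]; first by split; exists x.
case=> -[x [cx Ux] <-] [z [cz Vz]] /(congr1 (chart_inv c)).
by rewrite !chart_mapK// => zx; exists x => //; split=> //; split=> //; rewrite -zx.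
Qed.

Fact atlas_open_bigU (I : Type) (f : I -> set atlas_space) :
  (forall i, atlas_open (f i)) -> atlas_open (\bigcup_i f i).
Proof.
move=> fo c Ac; rewrite setI_bigcupr image_bigcup.
by apply: bigcup_open => i _; exact: fo.
Qed.

HB.instance Definition _ := isOpenTopological.Build atlas_space
  atlas_openT atlas_openI atlas_open_bigU.

Lemma atlas_openE (U : set atlas_space) : open U = atlas_open U.
Proof. by []. Qed.

End AtlasTopology.

Record manifold (d : nat) (M : choiceType) := Manifold {
  atlas : set (chart d M);
  atlas_cover : forall x, exists c, atlas c /\ chart_dom c x;
  atlas_compat : forall c c', atlas c -> atlas c' ->
    analytic_on (c @` (chart_dom c `&` chart_dom c')) (c' \o chart_inv c);
  atlas_hausdorff : hausdorff_space (atlas_space atlas) }.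

Definition mspace d M (X : manifold d M) : topologicalType :=
  atlas_space (atlas X).

(* Openness of the domains of the coordinate expressions (part of analytic_on)
   yields the continuity of f. *)
Definition is_analytic m n (M N : choiceType) (X : manifold m M)
    (Y : manifold n N) (f : M -> N) : Prop :=
  forall c c', atlas X c -> atlas Y c' ->
    analytic_on (c @` (chart_dom c `&` f @^-1` chart_dom c'))
                (c' \o f \o chart_inv c).

(* The tangent space at x is identified with K^d through the chart chart_at X x
   (two charts around x give identifications differing by the invertible
   derivative of the change of charts); tangent_map is the matrix of T_x f. *)
Definition chart_at d M (X : manifold d M) (x : M) : chart d M :=
  projT1 (cid (atlas_cover X x)).

Definition tangent_map m n (M N : choiceType) (X : manifold m M)
    (Y : manifold n N) (f : M -> N) (x : M) : 'M[K]_(m, n) :=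
  jacobian (chart_at Y (f x) \o f \o chart_inv (chart_at X x)) (chart_at X x x).

Section GlobalChart.
Variables (d : nat) (M : choiceType) (f : M -> 'rV[K]_d) (g : 'rV[K]_d -> M).
Hypotheses (fK : cancel f g) (gK : cancel g f).

Definition global_chart : chart d M :=
  @Chart d M setT setT f g (fun _ _ => I) (fun _ _ => I)
    (fun x _ => fK x) (fun y _ => gK y) openT.

Fact global_cover x : exists c, [set global_chart] c /\ chart_dom c x.
Proof. by exists global_chart. Qed.

Lemma global_image (D : set M) : f @` D = g @^-1` D.
Proof.
apply/seteqP; split=> [_ [x Dx <-]|y Dy]; first by rewrite /= fK.
by exists (g y).
Qed.

Fact global_compat c c' : [set global_chart] c -> [set global_chart] c' ->
  analytic_on (c @` (chart_dom c `&` chart_dom c')) (c' \o chart_inv c).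
Proof.
move=> -> -> /=; apply: (@affine_analytic _ _ _ _ _ 1%:M) => [a h|].
  by rewrite /= !gK mulmx1.
rewrite setIT global_image; exact: openT.
Qed.

Fact global_hausdorff : hausdorff_space (atlas_space [set global_chart]).
Proof.
move=> x y xy; apply: (can_inj fK); apply: rV_hausdorff => U V.
rewrite !nbhsE => -[U' [oU' U'x] U'U] [V' [oV' V'y] V'V].
have S (W : set 'rV[K]_d) z : open W -> W (f z) ->
    nbhs (z : atlas_space [set global_chart]) (f @^-1` W).
  move=> oW Wz; rewrite nbhsE; exists (f @^-1` W) => //; split=> //.
  rewrite atlas_openE => _ ->.
  rewrite setTI global_image; suff -> : g @^-1` (f @^-1` W) = W by [].
  by apply/seteqP; split=> w /=; rewrite gK.
have [z [/= Uz Vz]] := xy _ _ (S U' x oU' U'x) (S V' y oV' V'y).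
by exists (f z); split; [exact: U'U|exact: V'V].
Qed.

Definition global_manifold : manifold d M :=
  Manifold global_cover global_compat global_hausdorff.

End GlobalChart.

Definition matrix_manifold m n : manifold (m * n) 'M[K]_(m, n) :=
  global_manifold (@mxvecK K m n) (@vec_mxK K m n).

Section LieGroups.
Local Open Scope group_scope.

(* Analyticity of the multiplication is stated in the product charts of G x G. *)
Record lie_group (d : nat) (G : groupType) := LieGroup {
  lie_manifold :> manifold d G;
  lie_mul_analytic : forall c1 c2 c3, atlas lie_manifold c1 ->
    atlas lie_manifold c2 -> atlas lie_manifold c3 ->
    analytic_on
      [set z | exists x y, [/\ chart_dom c1 x, chart_dom c2 y,
                 chart_dom c3 (x * y) & z = row_mx (c1 x) (c2 y)]]
      (fun z => c3 (chart_inv c1 (lsubmx z) * chart_inv c2 (rsubmx z)));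
  lie_inv_analytic :
    is_analytic lie_manifold lie_manifold (fun x : G => x^-1) }.

(* Ad g is the derivative at 1 of conjugation by g, an endomorphism of the
   tangent space T_1 G underlying the Lie algebra. *)
Definition Ad d (G : groupType) (L : lie_group d G) (g : G) : 'M[K]_d :=
  tangent_map L L (fun x : G => g * x * g^-1) 1.

Definition lie_isomorphic m n (G H : groupType) (X : lie_group m G)
    (Y : lie_group n H) : Prop :=
  exists (f : {multiplicative G -> H}) (g : H -> G),
    [/\ cancel f g, cancel g f, is_analytic X Y f & is_analytic Y X g].

(* The Lie group structure of G/N is the one for which G -> G/N is a
   submersion. *)
Definition is_quotient_lie_group m n (G : groupType) (L : lie_group m G)
    (N : normal_subgroup G) (Q : lie_group n (quotient_group N)) : Prop :=
  is_analytic L Q (@quotient_map G N) /\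
  forall x, row_full (tangent_map L Q (@quotient_map G N) x).

(* Analytic homomorphisms G -> GL_n(Q_p): GL_n is an open submanifold of the
   affine space of n x n matrices. *)
Definition is_analytic_rep d (G : groupType) (L : lie_group d G) n
    (psi : G -> 'M[K]_n) : Prop :=
  [/\ forall x, psi x \in unitmx,
      forall x y, psi (x * y) = psi x *m psi y &
      is_analytic L (matrix_manifold n n) psi].

End LieGroups.

Section PadicLieGroup.
Local Notation G := (padic_group p_pr).

Let to_row (x : G) : 'rV[K]_1 := const_mx (x : K).
Let of_row (y : 'rV[K]_1) : G := y 0 0.

Fact to_rowK : cancel to_row of_row. Proof. by move=> x; rewrite /of_row mxE. Qed.
Fact of_rowK : cancel of_row to_row.
Proof. by move=> y; apply/rowP => i; rewrite ord1 mxE. Qed.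

Definition padic_manifold : manifold 1 G := global_manifold to_rowK of_rowK.

Fact padic_mul_analytic c1 c2 c3 : atlas padic_manifold c1 ->
  atlas padic_manifold c2 -> atlas padic_manifold c3 ->
  analytic_on
    [set z | exists x y, [/\ chart_dom c1 x, chart_dom c2 y,
               chart_dom c3 (x * y)%g & z = row_mx (c1 x) (c2 y)]]
    (fun z => c3 (chart_inv c1 (lsubmx z) * chart_inv c2 (rsubmx z))%g).
Proof.
move=> -> -> -> /=; apply: (@affine_analytic _ _ _ _ _ (col_mx 1%:M 1%:M)).
  move=> a h; have -> : h *m col_mx 1%:M 1%:M = lsubmx h + rsubmx h.
    by rewrite -{1}[h]hsubmxK mul_row_col !mulmx1.
  apply/rowP => i; rewrite ord1 /to_row /of_row.
  rewrite [LHS]mxE [RHS]mxE [in RHS]mxE !linearD/=.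
  have mE (x y : G) : (x * y)%g = (x : K) + (y : K) by [].
  have addE (u v : 'rV[K]_1) : (u + v) 0 0 = u 0 0 + v 0 0 by rewrite mxE.
  by rewrite !mE !addE addrACA.
set S := [set z | _]; suff -> : S = setT by exact: openT.
apply/seteqP; split=> // z _.
exists (of_row (lsubmx z)), (of_row (rsubmx z)); split=> //.
by rewrite !of_rowK hsubmxK.
Qed.

Fact padic_inv_analytic :
  is_analytic padic_manifold padic_manifold (fun x : G => x^-1)%g.
Proof.
move=> c c' -> -> /=; apply: (@affine_analytic _ _ _ _ _ (- 1%:M)).
  move=> a h; rewrite mulmxN mulmx1; apply/rowP => i.
  by rewrite ord1 /= !mxE -opprD; congr (- _); rewrite /of_row mxE.
rewrite preimage_setT setIT (global_image to_rowK of_rowK); exact: openT.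
Qed.

Definition padic_lie_group : lie_group 1 G :=
  LieGroup padic_mul_analytic padic_inv_analytic.

End PadicLieGroup.
End Manifolds.

Definition discrete_subset (T : topologicalType) (S : set T) : Prop :=
  S `<=` isolated S.

(* Main.v *)
Require Import Defs.
From HB Require Import structures.
From mathcomp Require Import all_boot all_order all_algebra.
From mathcomp Require Import all_classical topology.
From mathcomp Require Import ring.

(* The copies of Q_p in G are compatible with a homomorphism phi : G -> Q_p that
   is the identity on each of them. Since p^n Z_p (taken in the first copy) is
   contained in the first n + 1 copies, it centralises G_n; hence the left cosets
   of the first copy, with phi as coordinate, form an atlas in which all group
   operations are affine, conjugations are the identity near 1, and subsets of
   ker phi are discrete. As K one takes ker phi, which contains G'.

   Let g <> 1 lie in an abelian subnormal S = C_m < ... < C_0 = G. For large n, g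
   lies in G_n but not in p^n Z_p. Choose u outside p^n Z_p in the last factor of
   G_(n+1) = G_n * Q_p, and set w_0 = u, w_(k+1) = w_k g w_k^-1. Then w_k is in
   C_k, so w_m is in S; but w_m is a reduced word beginning and ending with
   letters of Q_p, so it does not commute with g. *)

Set Implicit Arguments.
Unset Strict Implicit.
Unset Printing Implicit Defensive.

Import Order.TTheory GRing.Theory Num.Theory.

Local Open Scope classical_set_scope.

(** * p-adic absolute value and topology *)

Section PadicAbs.
Local Open Scope ring_scope.
Variables (p : nat) (p_pr : prime p).
Local Notation Zp := (padic_int p_pr).
Local Notation K := (padic p_pr).

Let p_gt0 n : (0 < p ^ n)%N. Proof. by rewrite expn_gt0 prime_gt0. Qed.

Lemma residue_nat k n : (k%:R : Zp) n = (k %% p ^ n)%N.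
Proof.
elim: k => [|k IH]; first by rewrite residue0 mod0n.
by rewrite mulrS residueD IH modnDmr modnDml.
Qed.

Lemma padic_int_factor (x : Zp) : x != 0 ->
  exists v (y : Zp), [/\ x = p%:R ^+ v * y, padic_int_abs x = p%:R ^- v & y 1%N != 0%N].
Proof.
move=> x0; have [v xv vP] := padic_int_absP x0.
(* Dividing the residue of x modulo p^(n+v) by p^v gives the residue of x / p^v modulo p^n. *)
have yP n : (x (n.+1 + v) %/ p ^ v = x (n + v) %/ p ^ v %[mod p ^ n])%N.
  by rewrite !modn_divl -expnD addSn residueS.
exists v, (padic_of p_pr yP); split=> //.
  apply/padic_int_eq => -[|n].
    by rewrite residueM expn0 modn1; have := residue_lt x 0; rewrite expn0; case: (x 0%N).
  rewrite residueM -natrX residue_nat /= modnMml modnMmr.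
  have [xn0 xnv] : _ /\ _ := vP (n.+1 + v)%N ltac:(by rewrite addSn ltnS leq_addl).
  rewrite [X in (X %% _)%N]mulnC divnK; first by rewrite residue_mod.
  by rewrite pfactor_dvdn// xnv.
rewrite /= expn1 add1n.
have [xn0 xnv] := vP v.+1 (leqnn _).
apply/negP => /eqP/eqP; rewrite -/(dvdn _ _) => pd.
have : (p ^ v.+1 %| x v.+1)%N.
  have pv : (p ^ v %| x v.+1)%N by rewrite pfactor_dvdn// xnv.
  by rewrite -(divnK pv) expnS dvdn_pmul2r.
by rewrite pfactor_dvdn// xnv ltnn.
Qed.

(** Bezout gives an inverse of each residue. The choices are independent, but uniqueness of inverses
    modulo p^n makes them a coherent sequence. *)
Lemma padic_int_unit_residue (u : Zp) : u 1%N != 0%N -> exists c, c * u = 1.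
Proof.
move=> u1; have uc n : exists c, (c * u n = 1 %[mod p ^ n])%N.
  have /coprimeP : coprime (u n) (p ^ n).
    case: n => [|n]; first by rewrite expn0 coprimen1.
    rewrite coprime_sym coprime_pexpl// prime_coprime// /dvdn.
    by have := residue_mod u 1 n; rewrite expn1 add1n => ->.
  case: n => [|n]; first by exists 0%N; rewrite expn0 !modn1.
  case=> [|[c d] /= cd].
    rewrite lt0n; apply: contra_neq u1 => E.
    by have := residue_mod u 1 n; rewrite add1n E mod0n.
  exists c; have -> : (c * u n.+1 = 1 + d * p ^ n.+1)%N.
    by rewrite -cd subnK// ltnW// -subn_gt0 cd.
  by rewrite addnC modnMDl.
pose c n := projT1 (cid (uc n)).
have cP n : (c n * u n = 1 %[mod p ^ n])%N by exact: (projT2 (cid (uc n))).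
have cS n : (c n.+1 = c n %[mod p ^ n])%N.
  have E : (c n.+1 * u n = 1 %[mod p ^ n])%N.
    have := congr1 (modn^~ (p ^ n)%N) (cP n.+1).
    rewrite !modn_dvdm ?dvdn_exp2l// => <-.
    by rewrite -modnMmr -residueS modnMmr.
  rewrite -[c n.+1]muln1 -[LHS]modnMmr -(cP n) modnMmr mulnCA.
  by rewrite -modnMmr E modnMmr muln1.
exists (padic_of p_pr cS); apply/padic_int_eq => n.
by rewrite residueM /= modnMml cP.
Qed.

Lemma padic_int_abs_p : padic_int_abs (p%:R : Zp) = p%:R^-1.
Proof.
have p2 : (p%:R : Zp) 2%N = p.
  by rewrite residue_nat modn_small// -{1}(expn1 p) ltn_exp2l// prime_gt1.
have p0 : (p%:R : Zp) != 0.
  by apply/padic_int_neq0P; exists 2; rewrite p2 -lt0n prime_gt0.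
have [v -> vP] := padic_int_absP p0; have [_] := vP v.+2 (leqnSn _).
rewrite residue_nat modn_small; last first.
  by rewrite -{1}(expn1 p) ltn_exp2l// prime_gt1.
by rewrite -{2}(expn1 p) pfactorK// => <-; rewrite expr1.
Qed.

Lemma padic_abs_of_int (a : Zp) : padic_abs (padic_of_int a) = padic_int_abs a.
Proof.
have h : padic_int_abs (1 : Zp) != 0 by rewrite padic_int_abs_eq0 oner_neq0.
have h1 : padic_int_abs (1 : Zp) = 1.
  by apply: (mulfI h); rewrite -padic_int_absM !mulr1.
have := padic_abs_frac a (oner_neq0 Zp).
by rewrite h1 /padic_of_int tofrac1 !divr1.
Qed.

Lemma padic_int_abs_le1 (a : Zp) : padic_int_abs a <= 1.
Proof.
have [->|a0] := eqVneq a 0; first by rewrite padic_int_abs0.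
have [v -> _] := padic_int_absP a0.
by rewrite invf_le1 ?exprn_gt0 ?ltr0n ?prime_gt0// exprn_ege1// ler1n prime_gt0.
Qed.

Lemma padic_abs1 : padic_abs (1 : K) = 1.
Proof.
have h : padic_abs (1 : K) != 0 by rewrite padic_abs_eq0 oner_neq0.
by apply: (mulfI h); rewrite -padic_absM !mulr1.
Qed.

Lemma padic_abs_pX n : padic_abs (p%:R ^+ n : K) = p%:R ^- n.
Proof.
rewrite -exprVn -padic_int_abs_p -padic_abs_of_int /padic_of_int rmorph_nat.
elim: n => [|n IH]; last by rewrite !exprS padic_absM IH.
by rewrite !expr0 padic_abs1.
Qed.

Lemma padic_pX_neq0 n : (p%:R ^+ n : K) != 0.
Proof.
rewrite -padic_abs_eq0 padic_abs_pX invr_eq0 expf_neq0//.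
by rewrite pnatr_eq0 -lt0n prime_gt0.
Qed.

Lemma padic_int_divP (a b : Zp) : b != 0 -> padic_int_abs a <= padic_int_abs b ->
  exists c, a = c * b.
Proof.
move=> b0; have [->|a0] := eqVneq a 0; first by exists 0; rewrite mul0r.
have [v [x [-> -> x1]]] := padic_int_factor a0.
have [w [y [-> -> y1]]] := padic_int_factor b0.
have [c cy] := padic_int_unit_residue y1.
have p1 : 1 < (p%:R : rat) by rewrite ltr1n prime_gt1.
rewrite lef_pV2 ?posrE ?exprn_gt0 ?(lt_trans ltr01 p1)// ler_eXn2l// => wv.
exists (p%:R ^+ (v - w) * x * c).
have -> : p%:R ^+ (v - w) * x * c * (p%:R ^+ w * y) =
    (p%:R ^+ (v - w) * p%:R ^+ w) * x * (c * y) by rewrite !mulrA; ring.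
by rewrite cy mulr1 -exprD subnK.
Qed.

(** After division by p^n, a fraction of absolute value at most 1 is integral by [padic_int_divP];
    the subgroups p^n Z_p thus become balls. *)
Lemma mem_ppow_padic_int n (x : K) : (x \in ppow_padic_int n) = (padic_abs x <= p%:R ^- n).
Proof.
have p0 : 0 < (p%:R : rat) by rewrite ltr0n prime_gt0.
apply/idP/idP => [/asboolP[a ->]|].
  rewrite padic_absM padic_abs_pX padic_abs_of_int ler_piMr ?padic_int_abs_le1//.
  by rewrite invr_ge0 exprn_ge0// ltW.
move=> xn; apply/asboolP.
have [[a b] /= b0 E] := padic_fracP (x / p%:R ^+ n).
have : padic_abs (x / p%:R ^+ n) <= 1.
  have -> : padic_abs (x / p%:R ^+ n) = padic_abs x * p%:R ^+ n.
    apply: (mulIf (x := p%:R ^- n)); first by rewrite invr_eq0 expf_neq0// gt_eqF.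
    rewrite -{1}padic_abs_pX -padic_absM divfK ?padic_pX_neq0//.
    by rewrite mulfK// expf_neq0// gt_eqF.
  by rewrite -ler_pdivlMr ?exprn_gt0// div1r.
rewrite E padic_abs_frac// ler_pdivrMr ?mul1r; last first.
  by rewrite lt_neqAle eq_sym padic_int_abs_eq0 b0 padic_int_abs_ge0.
move=> /(padic_int_divP b0)[c ac]; exists c.
rewrite -[x](divfK (padic_pX_neq0 n)) E ac padic_of_intM mulfK; first by rewrite mulrC.
by rewrite padic_of_int_eq0.
Qed.

Lemma pX_lt (e : rat) : 0 < e -> exists n, p%:R ^- n < e.
Proof.
move=> e0; have p0 : 0 < (p%:R : rat) by rewrite ltr0n prime_gt0.
exists (Num.bound e^-1); rewrite -[X in _ < X]invrK ltf_pV2 ?posrE ?exprn_gt0 ?invr_gt0//.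
apply: lt_le_trans (archi_boundP _) _; first by rewrite invr_ge0 ltW.
rewrite -natrX ler_nat; apply: ltnW; apply: ltn_expl; exact: prime_gt1.
Qed.

Lemma padic_notin_ppow (x : K) : x != 0 -> exists n, x \notin ppow_padic_int n.
Proof.
rewrite -padic_abs_eq0 => x0; have [|n xn] := @pX_lt (padic_abs x).
  by rewrite lt_neqAle eq_sym x0 padic_abs_ge0.
by exists n; rewrite mem_ppow_padic_int -ltNge.
Qed.

Lemma ppow_padic_int_proper n : exists x : K, x \notin ppow_padic_int n.
Proof.
have p1 : 1 < (p%:R : rat) by rewrite ltr1n prime_gt1.
(* The witness is p^(n-1); for n = 0 this is the inverse of p, treated apart because exponents are
   natural numbers. *)
case: n => [|n].
  exists (p%:R^-1); rewrite mem_ppow_padic_int -ltNge expr0 invr1.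
  suff -> : padic_abs (p%:R^-1 : K) = p%:R by [].
  have pp := padic_abs_pX 1; have p0 := padic_pX_neq0 1; rewrite !expr1 in pp p0.
  have h0 : (p%:R : rat) != 0 by rewrite gt_eqF// (lt_trans ltr01).
  apply: (mulIf (invr_neq0 h0)); rewrite -{1}pp -padic_absM mulVf// mulfV//.
  exact: (padic_abs_pX 0).
exists (p%:R ^+ n); rewrite mem_ppow_padic_int padic_abs_pX -ltNge.
by rewrite ltf_pV2 ?posrE ?exprn_gt0 ?(lt_trans ltr01 p1)// ltr_eXn2l.
Qed.

(** Vectors with entries in p^n Z_p form a neighbourhood of 0, so openness in coordinates becomes an
    algebraic condition on increments. *)
Lemma open_ppow d (E : set 'rV[K]_d) :
  (forall z, E z -> exists n, forall h : 'rV[K]_d,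
     (forall i, h 0 i \in ppow_padic_int n) -> E (z + h)) -> open E.
Proof.
move=> EP; rewrite openE => z Ez; have [n nP] := EP z Ez.
have p0 : 0 < (p%:R : rat) by rewrite ltr0n prime_gt0.
exists (fun i j => [set y | padic_dist (z i j) y < p%:R ^- n]) => [i j|y /= yP].
  apply/nbhs_ballP; exists (p%:R ^- n); first by rewrite /= invr_gt0 exprn_gt0.
  by move=> y; rewrite ballEmdist.
rewrite -[y](subrK z) addrC; apply: nP => i; rewrite mem_ppow_padic_int.
by rewrite mxE [X in _ + X]mxE ltW// -padic_absN opprB; exact: yP.
Qed.

(** [jacobian] picks an arbitrary derivative, so uniqueness has to be shown: increments p^n with n
    large give |1 - J| <= e for every e > 0. *)
Lemma jacobian_id (a : 'rV[K]_1) : jacobian (fun y : 'rV[K]_1 => y) a = 1%:M.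
Proof.
rewrite /jacobian; apply: xget_unique => [e e0|J JP].
  apply: (@filterE _ (nbhs (0 : 'rV[K]_1))) => h; rewrite mulmx1 [a + h]addrC addrK subrr vnorm0.
  by rewrite mulr_ge0 ?vnorm_ge0// ltW.
have v1 (u : 'rV[K]_1) : vnorm u = padic_abs (u 0 0).
  by rewrite /vnorm big_ord_recl big_ord0; apply/max_idPl; exact: padic_abs_ge0.
apply/rowP => i; rewrite ord1 !mxE eqxx; apply/eqP; rewrite eq_sym -subr_eq0.
rewrite -padic_abs_eq0 eq_le padic_abs_ge0 andbT; apply/ler_addgt0Pl => e e0.
rewrite addr0; have := JP e e0; rewrite -nbhs_nearE; case=> V V0 VP.
have /nbhs_ballP[r /= r0 rV] := V0 0 0; rewrite mxE in rV.
have [n nr] := pX_lt r0.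
have := VP (const_mx (p%:R ^+ n)); rewrite /= => /(_ _)/wrap[].
  move=> i' j'; rewrite !ord1; apply: rV; rewrite ballEmdist /= /mdist /=.
  by rewrite /padic_dist sub0r padic_absN mxE padic_abs_pX.
rewrite !v1 !mxE big_ord1 !mxE [a 0 0 + _]addrC addrK.
have -> (c : K) : c - c * J 0 0 = c * (1 - J 0 0) by rewrite mulrBr mulr1.
rewrite padic_absM mulrC ler_pM2r//.
by rewrite lt_neqAle eq_sym padic_abs_eq0 padic_pX_neq0 padic_abs_ge0.
Qed.

End PadicAbs.

(** * Amalgamated products and normal forms *)

Section NormalForms.
Local Open Scope group_scope.

Lemma multiplicativeV (H K : groupType) (h : {multiplicative H -> K}) x :
  h x^-1 = (h x)^-1.
Proof.
by apply: (mulgI (h x)); rewrite -gmulfM !mulgV multiplicative1.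
Qed.

(** [tau] picks a representative of each right coset of f(B), and [beta] records the remaining
    B-part. *)
Lemma exists_transversal (B A : groupType) (f : {multiplicative B -> A}) :
  injective f ->
  exists (beta : A -> B) (tau : A -> A),
    [/\ forall a, a = f (beta a) * tau a,
        forall b a, tau (f b * a) = tau a & tau 1 = 1].
Proof.
move=> f_inj; pose coset (a : A) := [set a' | exists b, a' = f b * a].
have cosetM b a : coset (f b * a) = coset a.
  apply/seteqP; split=> [_ [c ->]|_ [c ->]].
    by exists (c * b); rewrite gmulfM mulgA.
  by exists (c * b^-1); rewrite gmulfM multiplicativeV mulgA mulgVK.
(* The trivial coset is represented by 1, so that elements of f(B) leave no letter in a normal
   form. *)
pose tau a := if pselect (coset 1 a) then 1 else xget 1 (coset a).
have tauP a : exists b, a = f b * tau a.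
  rewrite /tau; case: (pselect (coset 1 a)) => /= [h|_].
    by have [b E] := h; exists b.
  have [] := @xgetPex _ 1 (coset a); first by exists a, 1; rewrite multiplicative1 mul1g.
  move=> b E.
  by exists b^-1; rewrite multiplicativeV E mulKg.
have coset_mem b a : coset 1 (f b * a) <-> coset 1 a.
  split=> -[c E].
    by exists (b^-1 * c); rewrite gmulfM multiplicativeV -mulgA -E mulKg.
  by exists (b * c); rewrite E gmulfM mulgA.
exists (fun a => xget 1 [set b | a = f b * tau a]), tau; split=> [a|b a|].
- exact: (@xgetPex _ 1 [set b | a = f b * tau a] (tauP a)).
- rewrite /tau cosetM; case: (pselect (coset 1 (f b * a))); case: (pselect (coset 1 a)) => // h h'.
    by case: h; apply: (proj1 (coset_mem b a)).
  by case: h'; apply: (proj2 (coset_mem b a)).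
- by rewrite /tau; case: (pselect (coset 1 1)) => // -[]; exists 1; rewrite multiplicative1 mul1g.
Qed.

Variables (I : choiceType) (A : I -> groupType) (B : groupType).
Variable f : forall i, {multiplicative B -> A i}.

Notation word := (seq {i : I & A i}).
Notation letter i x := (@Tagged _ i (fun j => A j : Type) x).

Variable R : {i : I & A i} -> {i : I & A i} -> Prop.
Hypothesis glueP : forall u v, R u v ->
  exists b i j, u = letter i (f i b) /\ v = letter j (f j b).

Section Action.
Variables (beta : forall i, A i -> B) (tau : forall i, A i -> A i).
Hypotheses (f_inj : forall i, injective (f i))
  (beta_tau : forall i (a : A i), a = f i (beta a) * tau a)
  (tauM : forall i b (a : A i), tau (f i b * a) = tau a)
  (tau1 : forall i, tau (1 : A i) = 1).

Let betaE i b (a : A i) : a = f i b * tau a -> beta a = b.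
Proof. by rewrite {1}(beta_tau a) => /mulIg /f_inj. Qed.

Let betaM i b (a : A i) : beta (f i b * a) = b * beta a.
Proof. by apply: betaE; rewrite tauM gmulfM -mulgA -beta_tau. Qed.

Let tau_reduced i (t : A i) : tau t = t -> beta t = 1.
Proof. by move=> tt; apply: betaE; rewrite multiplicative1 mul1g tt. Qed.

(* An element of the amalgam is encoded by its normal form (b, t_1 ... t_k), the
   element b t_1 ... t_k with t_l <> 1 a transversal element of the l-th factor.
   [pull i] absorbs b and, if it is of type i, the letter t_1 into A i; [push] is
   its inverse, and A i acts by translation through this bijection. *)
Definition headed i (w : word) := if w is u :: _ then tag u == i else false.

Definition pull i (x : B * word) : A i * word :=
  if x.2 is u :: w then
    if tag u =P i is ReflectT e then (f i x.1 * etagged e, w)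
    else (f i x.1, x.2)
  else (f i x.1, x.2).

Definition push i (y : A i * word) : B * word :=
  (beta y.1, if tau y.1 == 1 then y.2 else letter i (tau y.1) :: y.2).

Fixpoint reduced (w : word) : Prop :=
  if w is u :: w' then
    [/\ tau (tagged u) = tagged u, tagged u <> 1,
        ~~ headed (tag u) w' & reduced w']
  else True.

Lemma pull_cons i b (t : A i) w : pull i (b, letter i t :: w) = (f i b * t, w).
Proof.
by rewrite /pull /=; case: eqP => // e; rewrite (eq_irrelevance e erefl).
Qed.

Lemma pull_unheaded i b w : ~~ headed i w -> pull i (b, w) = (f i b, w).
Proof. by rewrite /pull/=; case: w => //= u w; case: eqP. Qed.

Lemma pushK i (y : A i * word) : ~~ headed i y.2 -> pull i (push y) = y.
Proof.
case: y => a w /= wi; rewrite /push /=; case: eqP => ta.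
  by rewrite pull_unheaded// {2}(beta_tau a) ta mulg1.
by rewrite pull_cons -beta_tau.
Qed.

Lemma pullK i (x : B * word) : reduced x.2 -> push (pull i x) = x.
Proof.
case: x => b [|[j t] w] /=.
  move=> _; rewrite pull_unheaded// /push/= -[f i b]mulg1 tauM tau1 eqxx betaM.
  by rewrite tau_reduced ?mulg1// tau1.
case=> tt t1 tw rw; have [ij|ij] := eqVneq j i.
  subst j; rewrite pull_cons /push /= tauM tt betaM tau_reduced// mulg1.
  by case: eqP.
rewrite pull_unheaded// /push/= -[f i b]mulg1 tauM tau1 eqxx betaM.
by rewrite tau_reduced ?mulg1// tau1.
Qed.

Lemma pull_reduced i (x : B * word) : reduced x.2 ->
  reduced (pull i x).2 /\ ~~ headed i (pull i x).2.
Proof.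
case: x => b [|[j t] w] //= [tt t1 tw rw]; have [ij|ij] := eqVneq j i.
  by subst j; rewrite pull_cons.
by rewrite pull_unheaded.
Qed.

Lemma push_reduced i (y : A i * word) : reduced y.2 -> ~~ headed i y.2 ->
  reduced (push y).2.
Proof.
case: y => a w /= rw wi; rewrite /push /=; case: eqP => //= ta; split=> //.
by rewrite -(tauM (beta a)) -beta_tau.
Qed.

Definition act i (a : A i) (x : B * word) : B * word :=
  push (a * (pull i x).1, (pull i x).2).

Lemma act_reduced i (a : A i) x : reduced x.2 -> reduced (act a x).2.
Proof. by move=> /(pull_reduced i)[r h]; apply: push_reduced. Qed.

Lemma act1 i x : reduced x.2 -> act (1 : A i) x = x.
Proof. by move=> rx; rewrite /act mul1g -surjective_pairing pullK. Qed.

Lemma actM i (a b : A i) x : reduced x.2 -> act (a * b) x = act a (act b x).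
Proof.
move=> rx; rewrite /act pushK /=; first by rewrite mulgA.
by case: (pull_reduced i rx).
Qed.

(** Through every factor, b acts in the same way, on the B-coordinate only; this is why the action
    respects the gluing relations. *)
Lemma act_glue i b x : reduced x.2 -> act (f i b) x = (b * x.1, x.2).
Proof.
move=> rx; rewrite /act /push /= tauM betaM.
by have := pullK i rx; rewrite /push; case: x rx => c w /= _ [-> ->].
Qed.

(** If no letter of type i appeared, the product of a with an element of f(B) would have trivial
    representative, which would put a itself in f(B). *)
Lemma act_headed i (a : A i) x : (~ exists b, a = f i b) ->
  ~~ headed i x.2 -> headed i (act a x).2.
Proof.
case: x => b w aP /= wi; rewrite /act pull_unheaded//= /push/=.
case: eqP => [t1|_]; last by rewrite /= eqxx.
case: aP; exists (beta (a * f i b) * b^-1); rewrite gmulfM multiplicativeV.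
apply: (mulIg (f i b)); rewrite mulgVK.
by rewrite [LHS]beta_tau t1 mulg1.
Qed.

Definition word_act (w : word) (x : B * word) :=
  foldr (fun u => act (tagged u)) x w.

Lemma word_act_reduced w x : reduced x.2 -> reduced (word_act w x).2.
Proof. by move=> rx; elim: w => //= u w; apply: act_reduced. Qed.

(** Makes the action descend to the glued group. Only reduced normal forms are compared, since
    [push] undoes [pull] there. *)
Lemma word_act_eq u v : word_eq R u v ->
  forall x, reduced x.2 -> word_act u x = word_act v x.
Proof.
elim=> {u v} //.
- by move=> u v _ IH x rx; rewrite IH.
- by move=> u v w _ IH _ IH' x rx; rewrite IH ?IH'.
- move=> u v u' v' _ IH _ IH' x rx; rewrite /word_act !foldr_cat.
  by rewrite -[foldr _ x u']/(word_act u' x) IH' // [LHS]IH //; apply: word_act_reduced.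
- by move=> i x rx /=; rewrite act1.
- by move=> i a b x rx /=; rewrite actM.
- by move=> u v /glueP[b [i [j [-> ->]]]] x rx /=; rewrite !act_glue.
Qed.

Definition glued_act (g : glued_group R) := word_act (repr g).

Lemma glued_actE w x : reduced x.2 -> glued_act (gluedW R w) x = word_act w x.
Proof. by apply: word_act_eq; apply/gluedW_eq; rewrite gluedW_repr. Qed.

Lemma glued_actM g h x : reduced x.2 ->
  glued_act (g * h) x = glued_act g (glued_act h x).
Proof. by move=> rx; rewrite [LHS]glued_actE// /word_act foldr_cat. Qed.

End Action.

Hypothesis f_inj : forall i, injective (f i).

(* H i x: the normal form x starts with a letter of type i. *)
Lemma glued_pingpong : exists (X : Type) (act : glued_group R -> X -> X)
    (x0 : X) (H : I -> X -> Prop),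
  [/\ forall g h x, act (g * h) x = act g (act h x),
      forall i, ~ H i x0,
      forall i j x, H i x -> H j x -> i = j &
      forall i (a : A i) x, (~ exists b, a = f i b) -> ~ H i x ->
        H i (act (glued_in R a) x)].
Proof.
pose T i := exists_transversal (@f_inj i).
pose beta i := projT1 (cid (T i)); pose tau i := projT1 (cid (projT2 (cid (T i)))).
have P i := projT2 (cid (projT2 (cid (T i)))).
have P1 i (a : A i) : a = f i (beta i a) * tau i a by case: (P i) => H _ _; exact: H.
have P2 i b (a : A i) : tau i (f i b * a) = tau i a by case: (P i) => _ H _; exact: H.
have P3 i : tau i 1 = 1 by case: (P i).
pose ga g x := glued_act beta tau g x.
have ga_red g x : reduced tau x.2 -> reduced tau (ga g x).2.
  exact: (word_act_reduced P1 P2).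
(* Bundling reducedness into the type makes the action laws unconditional. *)
pose S := {x : B * word | reduced tau x.2}.
pose ac (g : glued_group R) (x : S) : S :=
  exist _ (ga g (sval x)) (ga_red _ _ (svalP x)).
have S_inj (x y : S) : sval x = sval y -> x = y.
  by case: x y => x rx [y ry] /= xy; subst y; congr exist; exact: Prop_irrelevance.
(* The base point is the normal form of 1: it has no letters, so no factor heads it. *)
exists S, ac, (exist _ (1, [::]) Logic.I), (fun i x => headed i (sval x).2).
split=> [g h [x rx]|i|i j [[b [|u w]] r] //= /eqP <- /eqP <-|i a [x rx] aP Hx] //=.
  by apply: S_inj; exact: (glued_actM f_inj P1 P2 P3).
rewrite /ga (glued_actE f_inj P1 P2 P3)//=.
by apply: (act_headed P1) => //; apply/negP.
Qed.

(** Each iteration descends one term of a subnormal chain whose last term contains g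
    ([subnormal_conj_iter]). *)
Fixpoint conj_iter (G : groupType) (g w : G) (k : nat) : G :=
  if k is l.+1 then conj_iter g w l * g * (conj_iter g w l)^-1 else w.

(** Ping-pong from the base point: applying b and then w gives a normal form headed by i, applying w
    and then b gives one headed by j. *)
Lemma conj_iter_not_commute i j (a : A i) (b : A j) k : i <> j ->
  (~ exists c, a = f i c) -> (~ exists c, b = f j c) ->
  let w := conj_iter (glued_in R b) (glued_in R a) k in
  w * glued_in R b <> glued_in R b * w.
Proof.
move=> ij aP bP w; have [X [ac [x0 [H [acM Hx0 HH Hac]]]]] := glued_pingpong.
have notV l (c : A l) : (~ exists d, c = f l d) -> ~ exists d, c^-1 = f l d.
  by move=> cP [d cd]; apply: cP; exists d^-1; rewrite multiplicativeV -cd invgK.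
have VE l (c : A l) : (glued_in R c)^-1 = glued_in R c^-1.
  by rewrite -multiplicativeV.
(* The inverse is carried along because the next iterate is v b v^-1: v^-1 leads into [H i], the
   letter b into [H j], and v back into [H i]. *)
have wP : forall x, ~ H i x -> H i (ac w x) /\ H i (ac w^-1 x).
  rewrite /w; elim: k {w} => [|k IH] x Hx /=.
    by split; [exact: Hac|rewrite VE; apply: Hac => //; exact: notV].
  set v := conj_iter _ _ k in IH *.
  have Hn y : H j y -> ~ H i y by move=> Hj Hi; apply: ij; apply: HH Hi Hj.
  have Hn' y : H i y -> ~ H j y by move=> Hj Hi; apply: ij; apply: HH Hj Hi.
  have [_ Hv] := IH _ Hx.
  rewrite !invgM !invgK mulgA !acM VE; split.
    by apply: (proj1 (IH _ _)); apply: Hn; apply: Hac => //; apply: Hn'.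
  by apply: (proj1 (IH _ _)); apply: Hn; apply: Hac; [exact: notV|exact: Hn'].
move=> /(congr1 (ac^~ x0)); rewrite !acM => E.
have H1 : H i (ac w (ac (glued_in R b) x0)).
  apply: (proj1 (wP _ _)) => Hi; apply: ij; apply: HH Hi _.
  exact: Hac.
have H2 : H j (ac (glued_in R b) (ac w x0)).
  apply: Hac => // Hj; apply: ij; apply: HH Hj; exact: (proj1 (wP _ _)).
by apply: ij; apply: HH H1 _; rewrite E.
Qed.
End NormalForms.

(** * The tower of iterated amalgams *)

Section Retractions.
Local Open Scope group_scope.

(** Above level n the maps are composites of retractions, below it composites of inclusions. The
    induction on n shifts the tower by one, hence the quantification over towers. *)
Lemma retraction_family n : forall (A : nat -> groupType)
    (j : forall n, {multiplicative A n -> A n.+1})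
    (r : forall n, {multiplicative A n.+1 -> A n}),
  (forall n, cancel (j n) (r n)) ->
  exists f : forall m, {multiplicative A m -> A n},
    (forall m a, f m.+1 (j m a) = f m a) /\ f n =1 id.
Proof.
elim: n => [|n IH] A j r rK.
  pose f := fix f m : {multiplicative A m -> A 0%N} :=
    if m is k.+1 then f k \o r k else idfun.
  by exists f; split=> // m a /=; rewrite rK.
have [f [fj fn]] := IH (fun m => A m.+1) (fun m => j m.+1) (fun m => r m.+1) (fun m => rK m.+1).
exists (fun m => match m return {multiplicative A m -> A n.+1} with
  | k.+1 => f k | 0%N => f 0%N \o j 0%N end); split=> //.
by case.
Qed.

Lemma union_in_retraction (A : nat -> groupType)
    (j : forall n, {multiplicative A n -> A n.+1}) n :
  (forall n, exists r : {multiplicative A n.+1 -> A n}, cancel (j n) r) ->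
  exists h : {multiplicative union_group j -> A n}, cancel (union_in j n) h.
Proof.
move=> rP; pose r m := projT1 (cid (rP m)).
have [|f [fj fn]] := @retraction_family n A j r.
  by move=> m; exact: (projT2 (cid (rP m))).
have [h [hf _]] := union_rec fj.
by exists h => a; rewrite hf fn.
Qed.

(** The pushout property applies to the identity of A1 and to g, which agree on B: the second factor
    is folded into the first. *)
Lemma amalgam_inl_retraction (B A1 A2 : groupType)
    (f : {multiplicative B -> A2}) (g : {multiplicative A2 -> A1}) :
  exists r : {multiplicative amalgam (g \o f) f -> A1}, cancel (amalgam_inl (g \o f) f) r.
Proof.
have [|h [hl _ _]] := @amalgam_pushout _ _ _ (g \o f) f A1 idfun g; first by [].
by exists h.
Qed.

Lemma glued_ind (I : choiceType) (A : I -> groupType) R (P : @glued_group I A R -> Prop) :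
  P 1 -> (forall i (a : A i) x, P x -> P (glued_in R a * x)) -> forall x, P x.
Proof.
move=> P1 PM x; have [w ->] := gluedWP x; elim: w => [//|[i a] w IH].
have -> : gluedW R (existT _ i a :: w) = glued_in R a * gluedW R w.
  by rewrite [RHS]glued_mulE.
exact: PM.
Qed.

End Retractions.

(** * Copies of Q_p in the union and their centralisers *)

Section Tower.
Local Open Scope group_scope.
Variables (p : nat) (p_pr : prime p).
Local Notation G := (amalgam_union p_pr).
Local Notation pZp n := (@ppow_padic_int p p_pr n).

Definition tower n : {multiplicative iterated_amalgam p_pr n -> G} :=
  union_in (@iterated_incl p p_pr) n.

(** Folding each new copy of Q_p onto the preceding one retracts the union onto every stage.
    Injectivity of the stages follows, and stage 0 yields the coordinate [phi]. *)
Lemma tower_retraction n :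
  exists h : {multiplicative G -> iterated_amalgam p_pr n}, cancel (tower n) h.
Proof.
apply: (@union_in_retraction _ (@iterated_incl p p_pr)) => m.
exact: (amalgam_inl_retraction (@ppow_incl p p_pr m)).
Qed.

Lemma tower_inj n : injective (tower n).
Proof. by have [h hK] := tower_retraction n; exact: can_inj hK. Qed.

Lemma towerS n a : tower n.+1 (iterated_incl p_pr n a) = tower n a.
Proof. exact: union_inS. Qed.

Lemma tower_le m n a : (m <= n)%N -> exists b, tower n b = tower m a.
Proof. exact: union_in_le. Qed.

Definition copy n (x : padic_group p_pr) : G := tower n (last_copy (stage_at p_pr n) x).

Lemma copyM n : {morph copy n : x y / x * y}.
Proof. by move=> x y; rewrite /copy !gmulfM. Qed.

HB.instance Definition _ n := isMultiplicative.Build _ _ (copy n) (@copyM n).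

Lemma copyS n (x : padic_group p_pr) : x \in pZp n -> copy n.+1 x = copy n x.
Proof.
move=> xn; rewrite /copy -(@towerS n); apply: (congr1 (tower n.+1)).
exact/esym/(amalgam_square (last_copy (stage_at p_pr n) \o @ppow_incl p p_pr n)
  (@ppow_incl p p_pr n) (PpowInt xn)).
Qed.

Lemma ppow_padic_intS n : {subset pZp n.+1 <= pZp n}.
Proof.
move=> x /asboolP[a ->]; apply/asboolP; exists (p%:R * a)%R.
rewrite padic_of_intM mulrA exprSr; congr (_ * _ * _)%R.
by rewrite /padic_of_int rmorph_nat.
Qed.

Lemma ppow_padic_int_le m n : (m <= n)%N ->
  {subset pZp n <= pZp m}.
Proof.
elim: n => [|n IH]; first by rewrite leqn0 => /eqP->.
rewrite leq_eqVlt => /predU1P[-> //|mn] x /ppow_padic_intS; exact: IH.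
Qed.

Lemma copy_ppow n (x : padic_group p_pr) : x \in pZp n -> copy n x = copy 0 x.
Proof.
elim: n => // n IH xn; have xn' := ppow_padic_intS xn.
by rewrite copyS// IH.
Qed.

(** Induction on the stage: G_(m+1) is generated by G_m and a new abelian copy of Q_p, and that copy
    contains x by [copy_ppow]. *)
Lemma tower_central m n (a : iterated_amalgam p_pr m) x : (m <= n)%N ->
  x \in pZp n -> copy 0 x * tower m a = tower m a * copy 0 x.
Proof.
move=> + xn; elim: m a => [|m IH] a mn.
  have [y ->] : exists y, tower 0 a = copy 0 y by exists a.
  by rewrite -!copyM; congr copy; exact: addrC.
have xm := ppow_padic_int_le mn xn.
elim/glued_ind: a => [|s a y IHy]; first by rewrite multiplicative1 mul1g mulg1.
rewrite gmulfM mulgA; suff -> : forall s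
    (a : amalgam_factor (iterated_amalgam p_pr m) (padic_group p_pr) s),
    copy 0 x * tower m.+1 (glued_in _ a) = tower m.+1 (glued_in _ a) * copy 0 x.
  by rewrite -mulgA IHy mulgA.
case=> {s}a {IHy y}.
  rewrite -(copy_ppow xm).
  rewrite -[tower m.+1 _]/(copy m.+1 a) -!copyM; congr copy; exact: addrC.
rewrite -[glued_in _ a]/(iterated_incl p_pr m a) towerS; apply: IH; exact: ltnW.
Qed.

Lemma copy0_retraction : exists phi : {multiplicative G -> padic_group p_pr},
  cancel (copy 0) phi.
Proof. exact: (tower_retraction 0). Qed.

(** Applies [conj_iter_not_commute] to G_(n+1) as an amalgam of G_n and a new copy of Q_p. The
    amalgamated subgroup can be described in the first copy, since [copy n] and [copy 0] agree on
    p^n Z_p. *)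
Lemma conj_iter_tower_not_commute n (a : iterated_amalgam p_pr n) x k :
  (forall b, b \in pZp n -> tower n a <> copy 0 b) ->
  x \notin pZp n ->
  let w := conj_iter (tower n a) (copy n.+1 x) k in
  w * tower n a <> tower n a * w.
Proof.
move=> aP xP w.
have [phi phiK] := copy0_retraction.
pose f1 := last_copy (stage_at p_pr n) \o @ppow_incl p p_pr n.
pose f (s : bool) : {multiplicative ppow_group p_pr n ->
    amalgam_factor (iterated_amalgam p_pr n) (padic_group p_pr) s} :=
  if s as s0 return {multiplicative _ -> amalgam_factor _ _ s0}
  then (@ppow_incl p p_pr n : {multiplicative _ -> _}) else f1.
(* For the map into G_n, both images are moved to the first copy, where [phi] is a left inverse. *)
have f_inj s : injective (f s).
  move=> u v uv; apply: val_inj; case: s uv => //= /(congr1 (tower n)).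
  rewrite -![tower n _]/(copy n _) !copy_ppow; last 2 first.
  - exact: valP.
  - exact: valP.
  by move/(can_inj phiK).
pose R := amalgam_glue f1 (@ppow_incl p p_pr n).
have glueP u v : R u v -> exists b i j,
    u = Tagged (fun s => amalgam_factor _ _ s : Type) (f i b) /\
    v = Tagged (fun s => amalgam_factor _ _ s : Type) (f j b).
  by case=> b; exists b, false, true.
pose g0 : iterated_amalgam p_pr n.+1 := iterated_incl p_pr n a.
pose w0 : iterated_amalgam p_pr n.+1 := last_copy (stage_at p_pr n.+1) x.
have wE : w = tower n.+1 (conj_iter g0 w0 k).
  rewrite /w; elim: k {w} => //= k ->.
  by rewrite !gmulfM multiplicativeV towerS.
rewrite wE -(@towerS n) -!gmulfM => /tower_inj.
apply: (conj_iter_not_commute glueP f_inj (i := true) (j := false)) => //.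
- case=> b xb; case/negP: xP; rewrite [x]xb; exact: valP.
- case=> b ab; apply: (aP (ppow_val b)); first exact: valP.
  by rewrite -(copy_ppow (valP b)) ab.
Qed.

End Tower.

(** * Lie groups modelled on left cosets of Q_p *)

Section CosetLieGroup.
Local Open Scope group_scope.
Variables (p : nat) (p_pr : prime p) (G : groupType).
Local Notation K := (padic p_pr).
Local Notation PG := (padic_group p_pr).
Local Notation pZp n := (@ppow_padic_int p p_pr n).
Variables (phi : {multiplicative G -> PG}) (iota : {multiplicative PG -> G}).
(* All charts are restrictions of phi, so every coordinate expression is affine;
   centrality of small elements is only needed for domains to be open. *)
Hypothesis iotaK : cancel iota phi.
Hypothesis iota_central : forall g, exists n, forall x : PG, x \in pZp n ->
  iota x * g = g * iota x.

Definition row_of (x : PG) : 'rV[K]_1 := const_mx (x : K).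
Definition of_row (y : 'rV[K]_1) : PG := y ord0 ord0.

Lemma of_rowK : cancel of_row row_of.
Proof. by move=> y; apply/rowP => i; rewrite ord1 mxE. Qed.

Lemma row_ofK : cancel row_of of_row.
Proof. by move=> y; rewrite /of_row mxE. Qed.

Lemma row_ofM x y : row_of (x * y) = (row_of x + row_of y)%R.
Proof. by apply/rowP => i; rewrite !mxE. Qed.

Section Chart.
Variable g : G.

Definition coset_dom : set G := [set x | exists y, x = g * iota y].
(** The factor [(phi g)^-1] makes this the point of the coset of g with [phi]-value y, so that all
    charts share the coordinate [phi]. *)
Definition coset_inv (y : 'rV[K]_1) : G := g * iota ((phi g)^-1 * of_row y).

Fact coset_invP y : [set: 'rV[K]_1] y -> coset_dom (coset_inv y).
Proof. by move=> _; exists ((phi g)^-1 * of_row y). Qed.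

Lemma phi_coset_inv y : row_of (phi (coset_inv y)) = y.
Proof. by rewrite gmulfM iotaK mulVKg of_rowK. Qed.

Fact coset_mapK x : coset_dom x -> coset_inv (row_of (phi x)) = x.
Proof. by case=> y ->; rewrite /coset_inv row_ofK gmulfM iotaK mulKg. Qed.

Definition coset_chart : chart p_pr 1 G :=
  @Chart _ _ 1 G coset_dom setT (fun x => row_of (phi x)) coset_inv
    (fun _ _ => Logic.I) coset_invP coset_mapK (fun y _ => phi_coset_inv y) openT.

(** Right translation by [iota t] stays in the coset and shifts the coordinate by t. *)
Lemma open_coset_image (U : set G) :
  (forall x, U x -> exists n, forall t : PG, t \in pZp n -> U (x * iota t)) ->
  open (coset_chart @` (coset_dom `&` U)).
Proof.
move=> Ust; apply: open_ppow => _ [x [[y xy] /Ust[n nU]] <-].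
exists n => h hn; exists (x * iota (of_row h)).
  split; last by apply: nU; exact: hn.
  by exists (y * of_row h); rewrite gmulfM mulgA xy.
by rewrite /= gmulfM iotaK row_ofM of_rowK.
Qed.

End Chart.

Lemma coset_domM g x t : coset_dom g x -> coset_dom g (x * iota t).
Proof. by case=> y ->; exists (y * t); rewrite gmulfM mulgA. Qed.

Lemma coset_dom_id g : coset_dom g g.
Proof. by exists 1; rewrite multiplicative1 mulg1. Qed.

Definition coset_atlas : set (chart p_pr 1 G) := range coset_chart.

Fact coset_cover x : exists c, coset_atlas c /\ chart_dom c x.
Proof. by exists (coset_chart x); split; [exists x|exact: coset_dom_id]. Qed.

Lemma id_analytic (D : set 'rV[K]_1) (f : 'rV[K]_1 -> 'rV[K]_1) :
  (forall y, f y = y) -> open D -> analytic_on D f.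
Proof.
move=> fE; apply: (@affine_analytic _ _ _ _ _ (1%:M)%R) => a h.
by rewrite !fE mulmx1.
Qed.

Fact coset_compat c c' : coset_atlas c -> coset_atlas c' ->
  analytic_on (c @` (chart_dom c `&` chart_dom c')) (c' \o chart_inv c).
Proof.
move=> [g _ <-] [g' _ <-]; apply: id_analytic; first exact: phi_coset_inv.
apply: open_coset_image => x xg; exists 0%N => t _; exact: coset_domM.
Qed.

Lemma open_coset_space (U : set (atlas_space coset_atlas)) :
  (forall x, U x -> exists n, forall t : PG, t \in pZp n -> U (x * iota t)) -> open U.
Proof. by move=> Ust; rewrite atlas_openE => _ [g _ <-]; exact: open_coset_image. Qed.

Lemma nbhs_coset x : nbhs (x : atlas_space coset_atlas) (coset_dom x).
Proof.
apply: open_nbhs_nbhs; split; last exact: coset_dom_id.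
by apply: open_coset_space => y xy; exists 0%N => t _; exact: coset_domM.
Qed.

Lemma phi_continuous :
  continuous (fun x : atlas_space coset_atlas => row_of (phi x)).
Proof.
apply/continuousP => W oW; rewrite atlas_openE => _ [g _ <-].
suff -> : coset_chart g @` (coset_dom g `&` (fun x => row_of (phi x)) @^-1` W) = W by [].
apply/seteqP; split=> [_ [x [_ xW] <-] //|y yW].
exists (coset_inv g y); last exact: phi_coset_inv.
by split; [exact: coset_invP|rewrite /= phi_coset_inv].
Qed.

(** Points with different values of [phi] are separated by continuity of [phi]; distinct points with
    equal values lie in disjoint open cosets. *)
Fact coset_hausdorff : hausdorff_space (atlas_space coset_atlas).
Proof.
move=> x y xy.
have phixy : phi x = phi y.
  apply: (can_inj row_ofK); apply: (@rV_hausdorff p p_pr 1) => U V nU nV.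
  have [z [/= Uz Vz]] := xy _ _ (phi_continuous nU) (phi_continuous nV).
  by exists (row_of (phi z)).
have [z [[a za] [b zb]]] := xy _ _ (nbhs_coset x) (nbhs_coset y).
have ab : a = b.
  by apply: (mulgI (phi x)); rewrite {2}phixy -[a]iotaK -[b]iotaK -!gmulfM -za -zb.
by apply: (mulIg (iota a)); rewrite {2}ab -za -zb.
Qed.

Definition coset_manifold : manifold p_pr 1 G :=
  Manifold coset_cover coset_compat coset_hausdorff.

(** [phi] is injective on the open coset of x, so this neighbourhood meets S only in x. *)
Lemma coset_discrete (S : set G) : (forall x, S x -> phi x = 1) ->
  discrete_subset (S : set (mspace coset_manifold)).
Proof.
move=> S1 x Sx; split; first by rewrite inE.
exists (coset_dom x); first exact: nbhs_coset.
apply/seteqP; split=> [_ [[t ->] /S1]|_ ->]; last by split=> //; exact: coset_dom_id.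
by rewrite gmulfM iotaK (S1 _ Sx) mul1g => ->; rewrite multiplicative1 mulg1.
Qed.

Fact coset_mul_analytic c1 c2 c3 : atlas coset_manifold c1 ->
  atlas coset_manifold c2 -> atlas coset_manifold c3 ->
  analytic_on
    [set z | exists x y, [/\ chart_dom c1 x, chart_dom c2 y,
               chart_dom c3 (x * y) & z = row_mx (c1 x) (c2 y)]]
    (fun z => c3 (chart_inv c1 (lsubmx z) * chart_inv c2 (rsubmx z))).
Proof.
move=> [g1 _ <-] [g2 _ <-] [g3 _ <-].
apply: (@affine_analytic _ _ _ _ _ (col_mx 1%:M 1%:M)%R) => [a h|].
  have E z : row_of (phi (coset_inv g1 (lsubmx z) * coset_inv g2 (rsubmx z))) =
      (lsubmx z + rsubmx z)%R by rewrite gmulfM row_ofM !phi_coset_inv.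
  rewrite /= !E.
  have -> : (h *m col_mx 1%:M 1%:M = lsubmx h + rsubmx h)%R.
    by rewrite -{1}[h]hsubmxK mul_row_col !mulmx1.
  by rewrite !linearD/= addrACA.
apply: open_ppow => _ [x [y [x1 y2 xy3 ->]]].
(* A small increment of x commutes with y and moves to the right end of the product, so the product
   stays in its coset. *)
have [n nP] := iota_central y; exists n => h hn.
exists (x * iota (of_row (lsubmx h))), (y * iota (of_row (rsubmx h))).
split; [exact: coset_domM|exact: coset_domM| |].
  rewrite -mulgA [iota _ * _]mulgA nP; last by rewrite /of_row mxE.
  by rewrite !mulgA; do 2 apply: coset_domM.
by rewrite /= !gmulfM !iotaK !row_ofM !of_rowK -add_row_mx hsubmxK.
Qed.

Fact coset_inv_analytic :
  is_analytic coset_manifold coset_manifold (fun x : G => x^-1).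
Proof.
move=> _ _ [g _ <-] [g' _ <-].
apply: (@affine_analytic _ _ _ _ _ (- 1%:M)%R) => [a h|].
  have E y : row_of (phi (coset_inv g y)^-1) = (- y)%R.
    rewrite -[y in RHS](phi_coset_inv g) multiplicativeV.
    by apply/rowP => i; rewrite !mxE.
  by rewrite /= !E mulmxN mulmx1 opprD.
(* Inversion puts the increment on the left of x^-1; centrality brings it back to the right. *)
apply: open_coset_image => x xg'; have [n nP] := iota_central x^-1.
exists n => t tn; rewrite /= invgM -multiplicativeV nP; first exact: coset_domM.
by rewrite -[_^-1]/(- (t : K))%R rpredN.
Qed.

Definition coset_lie_group : lie_group p_pr 1 G :=
  LieGroup coset_mul_analytic coset_inv_analytic.

End CosetLieGroup.

(** * Maps compatible with the coordinates *)

Section Maps.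
Local Open Scope group_scope.
Variables (p : nat) (p_pr : prime p) (G H : groupType).
Local Notation K := (padic p_pr).
Local Notation PG := (padic_group p_pr).
Local Notation pZp n := (@ppow_padic_int p p_pr n).
Variables (phi : {multiplicative G -> PG}) (iota : {multiplicative PG -> G}).
Variables (iotaK : cancel iota phi)
  (iota_central : forall g, exists n, forall x : PG, x \in pZp n ->
     iota x * g = g * iota x).
Variables (phi' : {multiplicative H -> PG}) (iota' : {multiplicative PG -> H}).
Variables (iotaK' : cancel iota' phi')
  (iota_central' : forall g, exists n, forall x : PG, x \in pZp n ->
     iota' x * g = g * iota' x).
Local Notation L := (coset_lie_group iotaK iota_central).
Local Notation L' := (coset_lie_group iotaK' iota_central').
Variable f : G -> H.
Hypothesis phif : forall x, phi' (f x) = phi x.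

(** In the charts, a map compatible with the coordinates is the identity of Q_p. This serves both
    for [Ad] and for the submersion onto the quotient. *)
Lemma coset_tangent_map x : tangent_map L L' f x = 1%:M%R.
Proof.
have [[g' _ E'] _] := projT2 (cid (atlas_cover L' (f x))).
have [[g _ E] _] := projT2 (cid (atlas_cover L x)).
rewrite /tangent_map /chart_at -E -E'.
suff -> : coset_chart iotaK' g' \o f \o chart_inv (coset_chart iotaK g) = id.
  exact: jacobian_id.
by apply/funext => y; rewrite /= phif phi_coset_inv.
Qed.

(** Equivariance under right translations is what makes the domains of the coordinate expressions
    open. *)
Lemma coset_map_analytic : (forall x t, f (x * iota t) = f x * iota' t) ->
  is_analytic L L' f.
Proof.
move=> fM _ _ [g _ <-] [g' _ <-]; apply: id_analytic.
  by move=> y; rewrite /= phif phi_coset_inv.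
apply: open_coset_image => x xg'; exists 0%N => t _.
by rewrite /= fM; exact: coset_domM.
Qed.
End Maps.

(** * Adjoint action, quotient by the kernel, and a unipotent representation *)

Section QuotientAndRep.
Local Open Scope group_scope.
Variables (p : nat) (p_pr : prime p) (G : groupType).
Local Notation K := (padic p_pr).
Local Notation PG := (padic_group p_pr).
Local Notation pZp n := (@ppow_padic_int p p_pr n).
Variables (phi : {multiplicative G -> PG}) (iota : {multiplicative PG -> G}).
Variables (iotaK : cancel iota phi)
  (iota_central : forall g, exists n, forall x : PG, x \in pZp n ->
     iota x * g = g * iota x).
Local Notation L := (coset_lie_group iotaK iota_central).

Lemma phiJ g x : phi (g * x * g^-1) = phi x.
Proof.
have C (a b : PG) : a * b = b * a by exact: addrC.
by rewrite !gmulfM multiplicativeV [phi g * _]C mulgK.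
Qed.

Lemma coset_Ad g : Ad L g = 1%:M%R.
Proof. by apply: coset_tangent_map => x; exact: phiJ. Qed.

Fact ker_normal : is_normal_in [set x | phi x = 1] setT.
Proof.
split=> //; first split=> /=.
- exact: multiplicative1.
- by move=> x y /= x1 y1; rewrite gmulfM x1 y1 mulg1.
- by move=> x /= x1; rewrite multiplicativeV x1 invg1.
by move=> g x _ /= x1; rewrite phiJ.
Qed.

Definition ker_group : normal_subgroup G := NormalSubgroup ker_normal.
Local Notation Q := (quotient_group ker_group).

Definition quotient_phi (x : Q) : PG := phi (repr x).

Lemma quotient_phiE x : quotient_phi (quotient_map ker_group x) = phi x.
Proof.
have /quotient_mapP /= : quotient_map ker_group (repr (quotient_map ker_group x)) =
  quotient_map ker_group x by exact: quotient_mapK.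
by rewrite gmulfM multiplicativeV => /mulg1_eq; rewrite invgK.
Qed.

Fact quotient_phiM : {morph quotient_phi : x y / x * y}.
Proof.
move=> x y; have [a ->] := quotient_map_surj x; have [b ->] := quotient_map_surj y.
by rewrite -quotient_mapM !quotient_phiE gmulfM.
Qed.

HB.instance Definition _ := isMultiplicative.Build Q PG quotient_phi quotient_phiM.

Definition quotient_iota (x : PG) : Q := quotient_map ker_group (iota x).

Fact quotient_iotaM : {morph quotient_iota : x y / x * y}.
Proof. by move=> x y; rewrite /quotient_iota gmulfM quotient_mapM. Qed.

HB.instance Definition _ := isMultiplicative.Build PG Q quotient_iota quotient_iotaM.

Lemma quotient_iotaK : cancel quotient_iota quotient_phi.
Proof. by move=> x; rewrite quotient_phiE iotaK. Qed.

Lemma quotient_phiK : cancel quotient_phi quotient_iota.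
Proof.
move=> x; have [a ->] := quotient_map_surj x; rewrite quotient_phiE.
by apply/quotient_mapP; rewrite /= gmulfM multiplicativeV iotaK mulVg.
Qed.

Fact quotient_iota_central g : exists n, forall x : PG, x \in pZp n ->
  quotient_iota x * g = g * quotient_iota x.
Proof.
exists 0%N => x _; rewrite -[g]quotient_phiK -!quotient_iotaM.
by congr quotient_iota; exact: addrC.
Qed.

(** The coset construction again; here [quotient_iota] is bijective, so there is a single coset and
    every chart is global. *)
Definition quotient_lie_group : lie_group p_pr 1 Q :=
  coset_lie_group quotient_iotaK quotient_iota_central.

Lemma quotient_is_quotient : is_quotient_lie_group L quotient_lie_group.
Proof.
split=> [|x].
  apply: coset_map_analytic => [x|x t]; first exact: quotient_phiE.
  by rewrite quotient_mapM.
rewrite coset_tangent_map; last exact: quotient_phiE.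
by rewrite row_full_unit unitmx1.
Qed.

Lemma quotient_isomorphic : lie_isomorphic quotient_lie_group (padic_lie_group p_pr).
Proof.
exists quotient_phi, quotient_iota; split.
- exact: quotient_phiK.
- exact: quotient_iotaK.
- move=> _ _ [g _ <-] ->; apply: id_analytic.
    by move=> y; exact: (phi_coset_inv quotient_iotaK g).
  by apply: open_coset_image => x _; exists 0%N => t _; exact: Logic.I.
- move=> _ _ -> [g _ <-]; apply: id_analytic.
    by move=> y; rewrite /= quotient_iotaK of_rowK.
  set D := _ @` _; suff -> : D = setT by exact: openT.
  apply/seteqP; split=> // y _; exists (of_row y); last exact: of_rowK.
  split=> //; exists ((quotient_phi g)^-1 * of_row y).
  by rewrite gmulfM multiplicativeV /= quotient_phiK mulVKg.
Qed.

(** The upper unitriangular matrix with corner entry a, which embeds the additive group Q_p in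
    GL_2. *)
Definition unipotent (a : K) : 'M[K]_2 := (1%:M + a *: delta_mx ord0 ord_max)%R.

Lemma unipotentD a b : unipotent (a + b)%R = (unipotent a *m unipotent b)%R.
Proof.
rewrite /unipotent mulmxDl !mulmxDr !mul1mx !mulmx1 -scalemxAl -scalemxAr.
by rewrite mul_delta_mx_0// !scaler0 addr0 scalerDl addrA addrAC.
Qed.

Lemma unipotent1 a : unipotent a = 1%:M%R -> a = 0%R.
Proof.
move=> /matrixP/(_ ord0 ord_max); rewrite !mxE !eqxx /= mulr1.
by rewrite add0r.
Qed.

Lemma unipotent_rep : is_analytic_rep L (fun x => unipotent (phi x)).
Proof.
have M x y : unipotent (phi (x * y)) = (unipotent (phi x) *m unipotent (phi y))%R.
  by rewrite -unipotentD gmulfM.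
split=> // [x|].
  have E : (unipotent (phi x) *m unipotent (phi x^-1%g) = 1%:M)%R.
    by rewrite -M mulgV multiplicative1 /unipotent scale0r addr0.
  exact: (proj1 (mulmx1_unit E)).
move=> _ _ [g _ <-] ->.
apply: (@affine_analytic _ _ _ _ _ (mxvec (delta_mx ord0 ord_max))) => [a h|].
  have E y : phi (coset_inv phi iota g y) = of_row y.
    by rewrite -[RHS](congr1 (@of_row p p_pr) (phi_coset_inv iotaK g y)) row_ofK.
  rewrite /= !E /unipotent.
  have -> : h = (of_row h)%:M%R.
    by apply/matrixP => i j; rewrite !ord1 !mxE eqxx mulr1n.
  rewrite mul_scalar_mx -!linearZ/= -linearD/=; congr mxvec.
  by rewrite -addrA -scalerDl; congr (_ + _ *: _)%R; rewrite /of_row !mxE eqxx mulr1n.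
by apply: open_coset_image => x _; exists 0%N => t _; exact: Logic.I.
Qed.

End QuotientAndRep.

(** * Subnormal subgroups and the theorem *)

Section Subnormal.
Local Open Scope group_scope.
Variables (p : nat) (p_pr : prime p).
Local Notation G := (amalgam_union p_pr).

(** The kernel is one of the subgroups being intersected, because conjugation does not change
    [phi]. *)
Lemma commutator_subgroup_ker (H : groupType) (phi : {multiplicative H -> padic_group p_pr}) x :
  commutator_subgroup x -> phi x = 1.
Proof.
move=> /(_ [set y | phi y = 1]); apply; split=> [|g h /=]; first by have [] := ker_normal phi.
by rewrite gmulfM phiJ multiplicativeV mulgV.
Qed.

Lemma copy0_central g : exists n, forall x : padic_group p_pr,
  x \in ppow_padic_int n -> copy 0 x * g = g * copy 0 x.
Proof.
have [n [a ->]] := union_inP g.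
by exists n => x xn; exact: tower_central (leqnn n) xn.
Qed.

(** The k-th iterate lies in C k and g in C (k+1), which is normal in C k; so the conjugate of g by
    that iterate is again in C (k+1). *)
Lemma subnormal_conj_iter (H : groupType) m (C : nat -> set H) g w :
  C 0%N w -> C m g -> (forall i, (i < m)%N -> is_normal_in (C i.+1) (C i)) ->
  C m (conj_iter g w m).
Proof.
move=> w0; elim: m => // m IH gm Cn; have [_ [_ CM CV] CS CJ] := Cn m (leqnn _).
have gm' := CS _ gm.
have wm : C m (conj_iter g w m) by apply: IH => // i im; apply: Cn; exact: ltnW.
exact: CJ.
Qed.

Lemma subnormal1 (H : groupType) (S : set H) : is_subnormal S -> S 1.
Proof.
case=> -[|m] [C [C0 <- Cn]]; first by rewrite C0.
by have [[]] := Cn m (leqnn _).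
Qed.

Lemma amalgam_union_no_abelian_subnormal (S : set G) :
  is_subnormal S -> is_abelian S -> S = [set 1].
Proof.
move=> Ssub Sab; apply/seteqP; split=> [g Sg|_ ->]; last exact: subnormal1.
apply: contrapT => g1; have [phi phiK] := copy0_retraction p_pr.
(* An equality [g = copy 0 x] forces x = phi g. This is excluded by g <> 1 if phi g is trivial, and
   otherwise by taking n so large that phi g is outside p^n Z_p. *)
have [n0 n0P] : exists n, forall x, x \in ppow_padic_int n -> g <> copy 0 x.
  have [pg|pg] := eqVneq (phi g) 1.
    exists 0%N => x _ gx; apply: g1.
    by move: pg; rewrite gx phiK => ->; exact: multiplicative1.
  have [n nP] := @padic_notin_ppow p p_pr (phi g) pg.
  by exists n => x xn gx; move: nP; rewrite gx phiK xn.
have [n [a ga]] := union_inP g.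
(* At level max(n, n0), g belongs to the stage and still avoids p^max(n, n0) Z_p, as these subgroups
   decrease. *)
have [b bg] := tower_le a (leq_maxl n n0).
have [x xP] := ppow_padic_int_proper p_pr (maxn n n0).
have bP y : y \in ppow_padic_int (maxn n n0) -> tower p_pr (maxn n n0) b <> copy 0 y.
  move=> yn; rewrite bg -[tower _ _ _]/(union_in _ _ a) -ga; apply: n0P.
  exact: ppow_padic_int_le (leq_maxr n n0) _ yn.
have {}bg : tower p_pr (maxn n n0) b = g by rewrite bg ga.
case: Ssub => m [C [C0 Cm Cn]].
(* The m-th iterate and g both lie in C m = S, so they would have to commute. *)
apply: (conj_iter_tower_not_commute (k := m) bP xP); rewrite bg; apply: Sab => //.
rewrite -Cm; apply: subnormal_conj_iter Cn; first by rewrite C0.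
by rewrite Cm.
Qed.

End Subnormal.

Local Open Scope ring_scope.

Theorem mainTheorem1 (p : nat) (p_pr : prime p) :
  exists L : lie_group p_pr 1 (amalgam_union p_pr),
  [/\ forall g : amalgam_union p_pr, Ad L g = 1%:M,
      ~ (exists S : set (amalgam_union p_pr),
          [/\ is_subnormal S, is_abelian S & S <> [set 1%g]]),
      exists K : normal_subgroup (amalgam_union p_pr),
        [/\ discrete_subset (nsub K : set (mspace L)),
            exists Q : lie_group p_pr 1 (quotient_group K),
              is_quotient_lie_group L Q /\
              lie_isomorphic Q (padic_lie_group p_pr) &
            exists psi : amalgam_union p_pr -> 'M[padic p_pr]_2,
              is_analytic_rep L psi /\
              nsub K = [set x | psi x = 1%:M]] &
      discrete_subset (@commutator_subgroup (amalgam_union p_pr) : set (mspace L))].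
Proof.
have [phi phiK] := copy0_retraction p_pr.
exists (coset_lie_group phiK (@copy0_central p p_pr)); split.
- exact: coset_Ad.
- by case=> S [Ssub Sab]; apply; exact: amalgam_union_no_abelian_subnormal.
- exists (ker_group phi); split.
  + exact: coset_discrete.
  + exists (quotient_lie_group phiK).
    by split; [exact: quotient_is_quotient|exact: quotient_isomorphic].
  + exists (fun x => unipotent (phi x)); split; first exact: unipotent_rep.
    apply/seteqP; split=> x /=; last exact: unipotent1.
    by move=> ->; rewrite /unipotent scale0r addr0.
- by apply: coset_discrete => x; exact: commutator_subgroup_ker.
Qed.
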